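(* If a random real $z$ computes a proper pruned incompressible tree, then $z\geq_T\emptyset'$.
   Context: $2^{<\omega}$ is the set of finite binary strings, $2^n$ the set of $n$-bit strings; reals are infinite binary sequences. $K$ is prefix-free Kolmogorov complexity. ''Random'' means Martin-Löf random; $\leq_T$ is Turing reducibility; $\emptyset'$ is the halting problem. A tree is a (nonempty) set $T\subseteq 2^{<\omega}$ that is downward-closed under the prefix relation $\preceq$. $T$ is pruned if it has no $\preceq$-maximal element; proper if $n\mapsto |T\cap 2^n|$ is unbounded; incompressible if $\sup_{\sigma\in T}(|\sigma|-K(\sigma))<\infty$. ''$z$ computes $T$'' means $T\leq_T z$ (as a set of strings). *)

(* Defs.v *)
From Stdlib Require Cantor.
From mathcomp Require Import all_boot zify.
Set Implicit Arguments. Unset Strict Implicit. Unset Printing Implicit Defensive.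

Definition npair (a b : nat) : nat := Cantor.to_nat (a, b).
Definition nfst (n : nat) : nat := (Cantor.of_nat n).1.
Definition nsnd (n : nat) : nat := (Cantor.of_nat n).2.

Lemma npair_inj2 a b a' b' : npair a b = npair a' b' -> a = a' /\ b = b'.
Proof. by move=> h; have [] := Cantor.to_nat_inj _ _ h. Qed.

(* Oracle mu-recursive functions, presented as unary functions on nat; several
   arguments are packed with the Cantor pairing. *)
Inductive code : Type :=
  | Zero
  | Succ
  | Fst
  | Snd
  | Oracle
  | Pair of code & code
  | Comp of code & code
  | Prec of code & code
  | Mu of code.

(* [eval X c n v]: program c with oracle X halts on input n with output v.
   Prec f g is defined on <a, m> by h(a, 0) = f(a) and
   h(a, m + 1) = g(a, m, h(a, m)); Mu f maps n to the least m with
   f(n, m) = 0, all earlier values being defined. *)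
Fixpoint eval (X : nat -> bool) (c : code) {struct c} : nat -> nat -> Prop :=
  match c with
  | Zero => fun n v => v = 0
  | Succ => fun n v => v = n.+1
  | Fst => fun n v => v = nfst n
  | Snd => fun n v => v = nsnd n
  | Oracle => fun n v => v = X n
  | Pair f g => fun n v =>
      exists a b, [/\ eval X f n a, eval X g n b & v = npair a b]
  | Comp f g => fun n v => exists2 a, eval X g n a & eval X f a v
  | Prec f g => fun n v =>
      let a := nfst n in
      (fix rec (m : nat) : nat -> Prop :=
         match m with
         | 0 => eval X f a
         | m'.+1 => fun w =>
             exists2 u, rec m' u & eval X g (npair a (npair m' u)) w
         end) (nsnd n) v
  | Mu f => fun n v =>
      eval X f (npair n v) 0 /\
      (forall k, k < v -> exists u, eval X f (npair n k) u.+1)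
  end.

Lemma eval_functional X c n v w : eval X c n v -> eval X c n w -> v = w.
Proof.
elim: c n v w => [|||||f Hf g Hg|f Hf g Hg|f Hf g Hg|f Hf] n v w /=; try congruence.
- by move=> [a [b [/Hf A /Hg B ->]]] [a' [b' [/A-> /B-> ->]]].
- by move=> [a /Hg A B] [a' /A<- C]; apply: Hf B C.
- elim: (nsnd n) v w => [|m IH] v w; first exact: Hf.
  by move=> [u /IH A B] [u' /A<- C]; apply: Hg B C.
- move=> [A B] [C D]; case: (ltngtP v w) => // h.
  + by have [u] := D _ h => E; have := Hf _ _ _ A E.
  + by have [u] := B _ h => E; have := Hf _ _ _ C E.
Qed.

Definition halts (X : nat -> bool) (c : code) (n : nat) : Prop :=
  exists v, eval X c n v.

Definition emptyset : nat -> bool := fun=> false.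

Definition turing_le (A : nat -> Prop) (X : nat -> bool) : Prop :=
  exists c, forall n, (A n -> eval X c n 1) /\ (~ A n -> eval X c n 0).

Fixpoint gnum (c : code) : nat :=
  match c with
  | Zero => npair 0 0
  | Succ => npair 1 0
  | Fst => npair 2 0
  | Snd => npair 3 0
  | Oracle => npair 4 0
  | Pair f g => npair 5 (npair (gnum f) (gnum g))
  | Comp f g => npair 6 (npair (gnum f) (gnum g))
  | Prec f g => npair 7 (npair (gnum f) (gnum g))
  | Mu f => npair 8 (gnum f)
  end.

Lemma gnum_inj : injective gnum.
Proof. by elim=> [|||||f Hf g Hg|f Hf g Hg|f Hf g Hg|f Hf] [|||||f' g'|f' g'|f' g'|f'] //= /npair_inj2[] //
 => _; [move=> /npair_inj2[/Hf-> /Hg->]..|move=> /Hf->]. Qed.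

(* The programs that halt on their own Goedel number. *)
Definition halting_problem (e : nat) : Prop :=
  exists c, e = gnum c /\ halts emptyset c e.

(* Bijective base 2, least significant digit first: a bijection onto nat. *)
Fixpoint str_num (s : seq bool) : nat :=
  match s with
  | [::] => 0
  | b :: s' => (str_num s').*2 + b.+1
  end.

Lemma str_num_inj : injective str_num.
Proof. elim=> [|b s IH] [|b' s'] //= h; try lia. 
have [-> /IH->] // : b = b' /\ str_num s = str_num s' by move: h; case: b; case: b' => /=; lia. Qed.

Lemma str_num_onto n : exists s, str_num s = n.
Proof. elim/ltn_ind: n => -[|n] IH; first by exists [::].
have [|s hs] := IH n./2; first by lia.
by exists (odd n :: s) => /=; rewrite hs; lia. Qed.

(* Since str_num is onto, every program is a partial computable function from
   strings to strings. *)
Definition machine (M : code) (p s : seq bool) : Prop :=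
  eval emptyset M (str_num p) (str_num s).

Definition prefix_free (M : code) : Prop :=
  forall p q s t, machine M p s -> machine M q t -> prefix p q -> p = q.

(* K_M(s) = k; no such k exists when s is not in the range of M. *)
Definition complexity (M : code) (s : seq bool) (k : nat) : Prop :=
  (exists2 p, machine M p s & size p = k) /\
  (forall p, machine M p s -> k <= size p).

(* U is an optimal prefix-free machine: for each prefix-free M there is a
   constant d with K_U <= K_M + d. The complexity K is K_U for such a U; it is
   then defined on all strings. *)
Definition universal_prefix_free (U : code) : Prop :=
  prefix_free U /\
  (forall M, prefix_free M ->
     exists d, forall s k, complexity M s k ->
       exists2 k', complexity U s k' & k' <= k + d).

(* Uniformly c.e. sets of strings W_0, W_1, ... *)
Definition unif_ce (c : code) (i : nat) (s : seq bool) : Prop :=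
  halts emptyset c (npair i (str_num s)).

(* The open set generated by W is the increasing union over N of the clopen
   sets generated by the strings of length at most N in W, so its uniform
   measure is at most 2^-i iff that of each of these is. The one at stage N is
   the union of the cylinders of those strings of length N extending an element
   of W, each of measure 2^-N; A ranges over finite sets of these. *)
Definition open_measure_le (W : seq bool -> Prop) (i : nat) : Prop :=
  forall (N : nat) (A : {set N.-tuple bool}),
    (forall t, t \in A -> exists2 s, W s & prefix s t) ->
    #|A| * 2 ^ i <= 2 ^ N.

Definition in_open (W : seq bool -> Prop) (z : nat -> bool) : Prop :=
  exists k, W (mkseq z k).

Definition ML_test (c : code) : Prop :=
  forall i, open_measure_le (unif_ce c i) i.

Definition ML_random (z : nat -> bool) : Prop :=
  forall c, ML_test c -> ~ (forall i, in_open (unif_ce c i) z).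

Definition tree (T : pred (seq bool)) : Prop :=
  (exists s, T s) /\ (forall s t, prefix s t -> T t -> T s).

Definition pruned_tree (T : pred (seq bool)) : Prop :=
  forall s, T s -> exists t, [/\ T t, prefix s t & t != s].

Definition proper_tree (T : pred (seq bool)) : Prop :=
  forall b, exists n, b < #|[set t : n.-tuple bool | T t]|.

Definition incompressible (U : code) (T : pred (seq bool)) : Prop :=
  exists d, forall s k, T s -> complexity U s k -> size s <= k + d.

Definition string_set (T : pred (seq bool)) (n : nat) : Prop :=
  exists2 s, T s & n = str_num s.

(* Main.v *)
(* Suppose z is random, computes T through the program c, and does not compute the
   halting problem. Let t_n be the least number of a certificate that the n-th
   instance of the halting problem halts (a partial computable function of n),
   and put w_n = 2^(4n+2). Every function computable from z is exceeded by t_n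
   for infinitely many n.

   For L = t_n, a greedy process enumerates a set F_n of strings of length L: at
   stage s, consider the strings t of length s for which c with oracle t accepts
   at least w_n strings of length L but none in F_n so far; a string of length L
   accepted for a measure at least 2^(2n-L) of these t is put into F_n. Each
   enumeration removes that much measure, so F_n has at most 2^(L-2n) elements,
   which makes them compressible by about n bits: T avoids F_n for almost all n.
   On the other hand, when no string qualifies, double counting bounds the
   measure of the t left over by 2^(2n)/w_n = 2^(-2n-2).

   The level at which T has width w_n is computable from z, so it is below t_n for
   infinitely many n, and then z is eventually among the oracles left over for n.
   Hence z can find, for each k, a stage at which this is witnessed for some
   n >= k; infinitely often t_k exceeds that stage. Waiting, from stage t_k on, for
   a stage at which no string qualifies for n therefore yields a Martin-Loef test
   that captures z. (This last step is the argument of Franklin and Ng that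
   incomplete random reals are difference random.) *)
Require Import Defs.
From Stdlib Require Import Classical.
From Stdlib Require Cantor.
From mathcomp Require Import all_boot zify.
Set Implicit Arguments. Unset Strict Implicit. Unset Printing Implicit Defensive.

(** * Computable functions between encoded types *)

Lemma nfst_pair a b : nfst (npair a b) = a.
Proof. by rewrite /nfst /npair Cantor.cancel_of_to. Qed.

Lemma nsnd_pair a b : nsnd (npair a b) = b.
Proof. by rewrite /nsnd /npair Cantor.cancel_of_to. Qed.

Lemma npair_eta n : npair (nfst n) (nsnd n) = n.
Proof. by rewrite /nfst /nsnd /npair -surjective_pairing Cantor.cancel_to_of. Qed.

Lemma leq_npairl a b : a <= npair a b.
Proof. have := Cantor.to_nat_non_decreasing a b; rewrite /npair; lia. Qed.

Lemma leq_npairr a b : b <= npair a b.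
Proof. have := Cantor.to_nat_non_decreasing a b; rewrite /npair; lia. Qed.

Lemma ltn_npairr a b : 0 < a -> b < npair a b.
Proof. have := Cantor.to_nat_non_decreasing a b; rewrite /npair; lia. Qed.

(** The first argument is fuel for the structural recursion; [n] itself suffices, since halving
    decreases the number. *)
Fixpoint unstr_rec (k n : nat) : seq bool :=
  match k, n with
  | k'.+1, n'.+1 => odd n' :: unstr_rec k' n'./2
  | _, _ => [::]
  end.

Definition unstr (n : nat) : seq bool := unstr_rec n n.

Lemma unstrK : cancel unstr str_num.
Proof.
suff H k n : n <= k -> str_num (unstr_rec k n) = n by move=> n; apply: H.
by elim: k n => [|k IH] [|n] hn //=; rewrite IH; lia.
Qed.

Lemma str_numK : cancel str_num unstr.
Proof. by move=> s; apply: str_num_inj; rewrite unstrK. Qed.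

Lemma size_str_num s : size s <= str_num s.
Proof. by elim: s => //= b s; lia. Qed.

Class Enc (T : Type) := enc : T -> nat.
Instance Enc_nat : Enc nat := id.
Instance Enc_bool : Enc bool := nat_of_bool.
Instance Enc_str : Enc (seq bool) := str_num.
Instance Enc_prod A B {HA : Enc A} {HB : Enc B} : Enc (A * B) :=
  fun p => npair (enc p.1) (enc p.2).

(** Keeping the oracle as a parameter lets one set of closure lemmas serve both the functions
    computable from [z] and, with [emptyset], the machine and the test. *)
Definition computable {A B} {HA : Enc A} {HB : Enc B} (X : nat -> bool) (f : A -> B) :=
  exists c, forall a, eval X c (enc a) (enc (f a)).

Fixpoint const_code (k : nat) : code :=
  if k is k'.+1 then Comp Succ (const_code k') else Zero.

Lemma eval_const X k n : eval X (const_code k) n k.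
Proof. by elim: k => //= k IH; exists k. Qed.

Lemma eval_prec0 X f g n a v : nfst n = a -> nsnd n = 0 ->
  eval X (Prec f g) n v <-> eval X f a v.
Proof. by move=> <- /= ->. Qed.

Lemma eval_precS X f g a m v :
  eval X (Prec f g) (npair a m.+1) v <->
  exists2 u, eval X (Prec f g) (npair a m) u & eval X g (npair a (npair m u)) v.
Proof. by rewrite /= !nfst_pair !nsnd_pair. Qed.

Section Closure.
Context (X : nat -> bool).
Context {A B C D : Type} {HA : Enc A} {HB : Enc B} {HC : Enc C} {HD : Enc D}.

Lemma computable_ext (f g : A -> B) : f =1 g -> computable X f -> computable X g.
Proof. by move=> e [c hc]; exists c => a; rewrite -e. Qed.

(** [Pair Fst Snd] computes the identity because the Cantor pairing is onto. *)
Lemma computable_id : computable X (fun a : A => a).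
Proof. by exists (Pair Fst Snd) => a /=; exists (nfst (enc a)), (nsnd (enc a)); rewrite npair_eta. Qed.

Lemma computable_const (b : B) : computable X (fun _ : A => b).
Proof. by exists (const_code (enc b)) => a; apply: eval_const. Qed.

Lemma computable_comp (g : B -> C) (f : A -> B) :
  computable X g -> computable X f -> computable X (fun a => g (f a)).
Proof. by move=> [d hd] [c hc]; exists (Comp d c) => a /=; exists (enc (f a)). Qed.

Lemma computable_pair (f : A -> B) (g : A -> C) :
  computable X f -> computable X g -> computable X (fun a => (f a, g a)).
Proof. by move=> [c hc] [d hd]; exists (Pair c d) => a /=; exists (enc (f a)), (enc (g a)). Qed.

Lemma computable_fst (f : A -> B * C) : computable X f -> computable X (fun a => (f a).1).
Proof. by move=> [c hc]; exists (Comp Fst c) => a /=; exists (enc (f a)); rewrite // nfst_pair. Qed.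

Lemma computable_snd (f : A -> B * C) : computable X f -> computable X (fun a => (f a).2).
Proof. by move=> [c hc]; exists (Comp Snd c) => a /=; exists (enc (f a)); rewrite // nsnd_pair. Qed.

(** Primitive recursion with the parameter [a]. The closure lemmas for arithmetic, bounded search
    and strings reduce to such iterations. *)
Lemma computable_iteri (n : A -> nat) (x : A -> B) (g : A -> nat -> B -> B) :
  computable X n -> computable X x ->
  computable X (fun p : A * (nat * B) => g p.1 p.2.1 p.2.2) ->
  computable X (fun a => iteri (n a) (g a) (x a)).
Proof.
move=> [c hc] [d hd] [e he].
exists (Comp (Prec d e) (Pair (Pair Fst Snd) c)) => a.
exists (npair (enc a) (n a)).
  by exists (enc a), (n a); split=> //; exists (nfst (enc a)), (nsnd (enc a)); rewrite npair_eta.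
elim: (n a) => [|m IH]; first by rewrite eval_prec0 ?nfst_pair ?nsnd_pair //; apply: hd.
by rewrite eval_precS; exists (enc (iteri m (g a) (x a))) => //; apply: he (a, (m, _)).
Qed.

End Closure.

Section Closure2.
Context (X : nat -> bool).
Context {A B C D E : Type} {HA : Enc A} {HB : Enc B} {HC : Enc C} {HD : Enc D} {HE : Enc E}.

Lemma computable_comp2 (F : B -> C -> D) (f : A -> B) (g : A -> C) :
  computable X (fun p : B * C => F p.1 p.2) ->
  computable X f -> computable X g -> computable X (fun a => F (f a) (g a)).
Proof. by move=> hF hf hg; apply: (computable_comp hF (computable_pair hf hg)). Qed.

Lemma computable_comp3 (F : B -> C -> D -> E) (f : A -> B) (g : A -> C) (h : A -> D) :
  computable X (fun p : B * C * D => F p.1.1 p.1.2 p.2) ->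
  computable X f -> computable X g -> computable X h ->
  computable X (fun a => F (f a) (g a) (h a)).
Proof.
move=> hF hf hg hh.
by apply: (computable_comp hF (computable_pair (computable_pair hf hg) hh)).
Qed.

Lemma computable_natb (f : A -> bool) : computable X f -> computable X (fun a => f a : nat).
Proof. by []. Qed.

Lemma computable_succ (f : A -> nat) : computable X f -> computable X (fun a => (f a).+1).
Proof. by move=> [c hc]; exists (Comp Succ c) => a /=; exists (f a). Qed.

Lemma computable_str_num (f : A -> seq bool) :
  computable X f -> computable X (fun a => str_num (f a)).
Proof. by []. Qed.

Lemma computable_unstr (f : A -> nat) : computable X f -> computable X (fun a => unstr (f a)).
Proof. by move=> [c hc]; exists c => a; rewrite /enc /Enc_str unstrK; apply: hc. Qed.

Lemma computable_npair (f g : A -> nat) :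
  computable X f -> computable X g -> computable X (fun a => npair (f a) (g a)).
Proof. by move=> [c hc] [d hd]; exists (Pair c d) => a /=; exists (f a), (g a). Qed.

Lemma computable_nfst (f : A -> nat) : computable X f -> computable X (fun a => nfst (f a)).
Proof. by move=> [c hc]; exists (Comp Fst c) => a /=; exists (f a). Qed.

Lemma computable_nsnd (f : A -> nat) : computable X f -> computable X (fun a => nsnd (f a)).
Proof. by move=> [c hc]; exists (Comp Snd c) => a /=; exists (f a). Qed.

Lemma computable_oracle (f : A -> nat) : computable X f -> computable X (fun a => X (f a)).
Proof. by move=> [c hc]; exists (Comp Oracle c) => a /=; exists (f a). Qed.

End Closure2.

(** A hook for [comp_step], redefined once the remaining closure lemmas are available. *)
Ltac comp_user := fail.
Ltac comp_hyp :=
  match goal with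
  | H : computable _ ?f |- computable _ (fun a => ?f (@?g a)) =>
      refine (@computable_comp _ _ _ _ _ _ _ f g H _)
  | H : computable _ (fun p => ?f p.1 p.2) |- computable _ (fun a => ?f (@?g a) (@?h a)) =>
      refine (@computable_comp2 _ _ _ _ _ _ _ _ _ f g h H _ _)
  | H : computable _ (fun p => ?f p.1.1 p.1.2 p.2) |-
      computable _ (fun a => ?f (@?g a) (@?h a) (@?k a)) =>
      refine (@computable_comp3 _ _ _ _ _ _ _ _ _ _ _ f g h k H _ _ _)
  end.
Ltac comp_step :=
  lazymatch goal with
  | |- computable _ (fun a => a) => exact: computable_id
  | |- computable _ (fun a => (@?f a, @?g a)) => refine (@computable_pair _ _ _ _ _ _ _ f g _ _)
  | |- computable _ (fun a => (@?f a).1) => refine (@computable_fst _ _ _ _ _ _ _ f _)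
  | |- computable _ (fun a => (@?f a).2) => refine (@computable_snd _ _ _ _ _ _ _ f _)
  | |- computable _ (fun a => (@?f a).+1) => refine (@computable_succ _ _ _ f _)
  | |- computable _ (fun a => nat_of_bool (@?f a)) => refine (@computable_natb _ _ _ f _)
  | |- computable _ (fun a => str_num (@?f a)) => refine (@computable_str_num _ _ _ f _)
  | |- computable _ (fun a => unstr (@?f a)) => refine (@computable_unstr _ _ _ f _)
  | |- computable _ (fun a => npair (@?f a) (@?g a)) => refine (@computable_npair _ _ _ f g _ _)
  | |- computable _ (fun a => nfst (@?f a)) => refine (@computable_nfst _ _ _ f _)
  | |- computable _ (fun a => nsnd (@?f a)) => refine (@computable_nsnd _ _ _ f _)
  | |- computable _ (fun a => iteri (@?n a) (@?g a) (@?x a)) =>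
      refine (@computable_iteri _ _ _ _ _ n x g _ _ _)
  | |- computable _ fst => exact: (computable_fst (@computable_id _ _ _))
  | |- computable _ snd => exact: (computable_snd (@computable_id _ _ _))
  | |- _ => first [exact: computable_const | assumption | comp_hyp | comp_user]
  end.
Ltac comp_auto := repeat (cbv beta; comp_step).

(** * Closure under arithmetic, bounded search and string operations *)

Lemma computable_if X {A B : Type} {HA : Enc A} {HB : Enc B} (b : A -> bool) (f g : A -> B) :
  computable X b -> computable X f -> computable X g ->
  computable X (fun a => if b a then f a else g a).
Proof.
move=> hb hf hg.
apply: (@computable_ext _ _ _ _ _ (fun a => iteri (b a) (fun _ _ => f a) (g a))).
  by move=> a; case: (b a).
by comp_auto.
Qed.

Lemma computable_pred X {A : Type} {HA : Enc A} (f : A -> nat) :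
  computable X f -> computable X (fun a => (f a).-1).
Proof.
move=> hf; apply: (@computable_ext _ _ _ _ _ (fun a => iteri (f a) (fun i _ => i) 0)).
  by move=> a; case: (f a).
by comp_auto.
Qed.

Lemma computable_addn X {A : Type} {HA : Enc A} (f g : A -> nat) :
  computable X f -> computable X g -> computable X (fun a => f a + g a).
Proof.
move=> hf hg; apply: (@computable_ext _ _ _ _ _ (fun a => iteri (g a) (fun _ y => y.+1) (f a))).
  by move=> a; elim: (g a) => [|m /= ->]; rewrite ?addn0 ?addnS.
by comp_auto.
Qed.

Lemma computable_subn X {A : Type} {HA : Enc A} (f g : A -> nat) :
  computable X f -> computable X g -> computable X (fun a => f a - g a).
Proof.
move=> hf hg; apply: (@computable_ext _ _ _ _ _ (fun a => iteri (g a) (fun _ y => y.-1) (f a))).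
  by move=> a; elim: (g a) => [|m IH] /=; rewrite ?IH; lia.
by comp_auto; apply: computable_pred; comp_auto.
Qed.

Lemma computable_muln X {A : Type} {HA : Enc A} (f g : A -> nat) :
  computable X f -> computable X g -> computable X (fun a => f a * g a).
Proof.
move=> hf hg; apply: (@computable_ext _ _ _ _ _ (fun a => iteri (g a) (fun _ y => y + f a) 0)).
  by move=> a; elim: (g a) => [|m IH] /=; rewrite ?IH; lia.
by comp_auto; apply: computable_addn; comp_auto.
Qed.

Lemma computable_negb X {A : Type} {HA : Enc A} (b : A -> bool) :
  computable X b -> computable X (fun a => ~~ b a).
Proof. by move=> hb; apply: computable_if; comp_auto. Qed.

Lemma computable_andb X {A : Type} {HA : Enc A} (b d : A -> bool) :
  computable X b -> computable X d -> computable X (fun a => b a && d a).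
Proof. by move=> hb hd; apply: computable_if; comp_auto. Qed.

Lemma computable_orb X {A : Type} {HA : Enc A} (b d : A -> bool) :
  computable X b -> computable X d -> computable X (fun a => b a || d a).
Proof. by move=> hb hd; apply: (@computable_if _ _ _ _ _ b xpredT d); comp_auto. Qed.

Lemma computable_implyb X {A : Type} {HA : Enc A} (b d : A -> bool) :
  computable X b -> computable X d -> computable X (fun a => b a ==> d a).
Proof. by move=> hb hd; apply: (@computable_if _ _ _ _ _ b d xpredT); comp_auto. Qed.

Lemma computable_eq0 X {A : Type} {HA : Enc A} (f : A -> nat) :
  computable X f -> computable X (fun a => f a == 0).
Proof.
move=> hf; apply: (@computable_ext _ _ _ _ _ (fun a => iteri (f a) (fun _ _ => false) true)).
  by move=> a; case: (f a).
by comp_auto.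
Qed.

Lemma computable_leq X {A : Type} {HA : Enc A} (f g : A -> nat) :
  computable X f -> computable X g -> computable X (fun a => f a <= g a).
Proof. by move=> hf hg; apply: computable_eq0; apply: computable_subn. Qed.

Lemma computable_eqn X {A : Type} {HA : Enc A} (f g : A -> nat) :
  computable X f -> computable X g -> computable X (fun a => f a == g a).
Proof.
move=> hf hg; apply: (@computable_ext _ _ _ _ _ (fun a => (f a <= g a) && (g a <= f a))).
  by move=> a; rewrite -eqn_leq.
by apply: computable_andb; apply: computable_leq.
Qed.

Lemma computable_expn X {A : Type} {HA : Enc A} (f g : A -> nat) :
  computable X f -> computable X g -> computable X (fun a => f a ^ g a).
Proof.
move=> hf hg; apply: (@computable_ext _ _ _ _ _ (fun a => iteri (g a) (fun _ y => y * f a) 1)).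
  by move=> a; elim: (g a) => [|m /= ->]; rewrite ?expn0 ?expnSr.
by comp_auto; apply: computable_muln; comp_auto.
Qed.

Lemma computable_odd X {A : Type} {HA : Enc A} (f : A -> nat) :
  computable X f -> computable X (fun a => odd (f a)).
Proof.
move=> hf; apply: (@computable_ext _ _ _ _ _ (fun a => iteri (f a) (fun _ y => ~~ y) false)).
  by move=> a; elim: (f a) => [|m /= ->].
by comp_auto; apply: computable_negb; comp_auto.
Qed.

(** The recursion rests on floor((i + 1)/2) = i - floor(i/2). *)
Lemma computable_half X {A : Type} {HA : Enc A} (f : A -> nat) :
  computable X f -> computable X (fun a => (f a)./2).
Proof.
move=> hf; apply: (@computable_ext _ _ _ _ _ (fun a => iteri (f a) (fun i y => i - y) 0)).
  by move=> a; elim: (f a) => [|m IH] /=; rewrite ?IH; lia.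
by comp_auto; apply: computable_subn; comp_auto.
Qed.

Lemma computable_sum X {A : Type} {HA : Enc A} (n : A -> nat) (F : A -> nat -> nat) :
  computable X n -> computable X (fun p => F p.1 p.2) ->
  computable X (fun a => \sum_(i < n a) F a i).
Proof.
move=> hn hF; apply: (@computable_ext _ _ _ _ _ (fun a => iteri (n a) (fun i y => y + F a i) 0)).
  by move=> a; elim: (n a) => [|m IH]; rewrite ?big_ord0 // big_ord_recr /= IH.
by comp_auto; apply: computable_addn; comp_auto.
Qed.

(** Before step [i] the state [y] is the result of the search below [i]; [y = i] means that nothing
    has been found. *)
Lemma computable_find X {A : Type} {HA : Enc A} (n : A -> nat) (P : A -> nat -> bool) :
  computable X n -> computable X (fun p => P p.1 p.2) ->
  computable X (fun a => find (P a) (iota 0 (n a))).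
Proof.
move=> hn hP; apply: (@computable_ext _ _ _ _ _
  (fun a => iteri (n a) (fun i y => if (y < i) || P a i then y else y.+1) 0)).
  move=> a; elim: (n a) => [|m IH] //; rewrite -{2}addn1 iotaD find_cat size_iota /= -IH.
  rewrite has_find size_iota add0n; have := find_size (P a) (iota 0 m); rewrite size_iota -IH.
  by case: ltngtP => //= e; case: (P a m); rewrite ?e; lia.
comp_auto; apply: computable_if; comp_auto.
by apply: computable_orb; last first; comp_auto; apply: computable_leq; comp_auto.
Qed.

Lemma computable_has X {A : Type} {HA : Enc A} (n : A -> nat) (P : A -> nat -> bool) :
  computable X n -> computable X (fun p => P p.1 p.2) ->
  computable X (fun a => has (P a) (iota 0 (n a))).
Proof.
move=> hn hP; apply: (@computable_ext _ _ _ _ _ (fun a => find (P a) (iota 0 (n a)) < n a)).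
  by move=> a; rewrite has_find size_iota.
by apply: computable_leq => //; apply: computable_succ; apply: computable_find.
Qed.

Lemma computable_all X {A : Type} {HA : Enc A} (n : A -> nat) (P : A -> nat -> bool) :
  computable X n -> computable X (fun p => P p.1 p.2) ->
  computable X (fun a => all (P a) (iota 0 (n a))).
Proof.
move=> hn hP; apply: (@computable_ext _ _ _ _ _ (fun a => ~~ has (fun i => ~~ P a i) (iota 0 (n a)))).
  by move=> a; rewrite -all_predC; apply: eq_all => i /=; rewrite negbK.
by apply: computable_negb; apply: computable_has => //; apply: computable_negb.
Qed.

Lemma computable_behead X {A : Type} {HA : Enc A} (f : A -> seq bool) :
  computable X f -> computable X (fun a => behead (f a)).
Proof.
move=> hf; apply: (@computable_ext _ _ _ _ _ (fun a => unstr (str_num (f a)).-1./2)).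
  move=> a; apply: str_num_inj; rewrite unstrK; case: (f a) => //= b s; lia.
by comp_auto; apply: computable_half; apply: computable_pred; comp_auto.
Qed.

(** In bijective base 2 a first bit [true] is the digit 2, so the code is positive and even. *)
Lemma computable_head X {A : Type} {HA : Enc A} (f : A -> seq bool) :
  computable X f -> computable X (fun a => head false (f a)).
Proof.
move=> hf; apply: (@computable_ext _ _ _ _ _ (fun a => (0 < str_num (f a)) && ~~ odd (str_num (f a)))).
  by move=> a; case: (f a) => //= b s; case: b; lia.
apply: computable_andb; first by apply: computable_leq; comp_auto.
by apply: computable_negb; apply: computable_odd; comp_auto.
Qed.

Lemma computable_cons X {A : Type} {HA : Enc A} (b : A -> bool) (f : A -> seq bool) :
  computable X b -> computable X f -> computable X (fun a => b a :: f a).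
Proof.
move=> hb hf; apply: (@computable_ext _ _ _ _ _
   (fun a => unstr (str_num (f a) + str_num (f a) + (b a).+1))).
  by move=> a; apply: str_num_inj; rewrite unstrK /= addnn.
by comp_auto; do 2?apply: computable_addn; comp_auto.
Qed.

Lemma computable_drop X {A : Type} {HA : Enc A} (n : A -> nat) (f : A -> seq bool) :
  computable X n -> computable X f -> computable X (fun a => drop (n a) (f a)).
Proof.
move=> hn hf; apply: (@computable_ext _ _ _ _ _ (fun a => iteri (n a) (fun _ s => behead s) (f a))).
  move=> a; elim: (n a) => [|m IH]; first by rewrite drop0.
  by rewrite /= IH -drop1 drop_drop.
by comp_auto; apply: computable_behead; comp_auto.
Qed.

Lemma computable_nth X {A : Type} {HA : Enc A} (n : A -> nat) (f : A -> seq bool) :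
  computable X n -> computable X f -> computable X (fun a => nth false (f a) (n a)).
Proof.
move=> hn hf; apply: (@computable_ext _ _ _ _ _ (fun a => head false (drop (n a) (f a)))).
  by move=> a; rewrite -nth0 nth_drop addn0.
by apply: computable_head; apply: computable_drop.
Qed.

Lemma computable_size X {A : Type} {HA : Enc A} (f : A -> seq bool) :
  computable X f -> computable X (fun a => size (f a)).
Proof.
move=> hf; apply: (@computable_ext _ _ _ _ _
   (fun a => find (fun k => str_num (drop k (f a)) == 0) (iota 0 (str_num (f a))))).
  (* The size is the least [k] for which dropping [k] bits leaves nothing. If the size equals the
     search bound, the default value of [find] is still right. *)
  move=> a; have hs := size_str_num (f a).
  set P := fun k => _; have hP k : P k = (size (f a) <= k).
    rewrite /P -subn_eq0 -size_drop; case: (drop k (f a)) => //= b s; lia.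
  rewrite (eq_find hP) -(subnKC hs) iotaD find_cat size_iota.
  rewrite -[X in has X _]/(fun k => size (f a) <= k).
  case: hasP => [[k]|_]; first by rewrite mem_iota; lia.
  by case: (_ - _) => [|m] //=; rewrite ?leqnn addn0.
apply: computable_find; comp_auto; apply: computable_eqn; comp_auto.
by apply: computable_drop; comp_auto.
Qed.

Lemma computable_mkseq X {A : Type} {HA : Enc A} (n : A -> nat) (F : A -> nat -> bool) :
  computable X n -> computable X (fun p => F p.1 p.2) ->
  computable X (fun a => mkseq (F a) (n a)).
Proof.
move=> hn hF; apply: (@computable_ext _ _ _ _ _
  (fun a => iteri (n a) (fun i s => F a ((n a).-1 - i) :: s) [::])).
  move=> a; set N := n a.
  suff H k : k <= N -> iteri k (fun i s => F a (N.-1 - i) :: s) [::] = map (F a) (iota (N - k) k).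
    by rewrite H // subnn.
  elim: k => [|k IH] hk //=; rewrite IH ?(ltnW hk) //.
  by congr (F a _ :: map _ (iota _ _)); lia.
comp_auto; apply: computable_cons; comp_auto.
by apply: computable_subn; comp_auto; apply: computable_pred; comp_auto.
Qed.

Ltac comp_user ::=
  lazymatch goal with
  | |- computable _ (fun a => if _ then _ else _) => apply: computable_if
  | |- computable _ (fun a => (@?f a).-1) => refine (@computable_pred _ _ _ f _)
  | |- computable _ (fun a => (@?f a)./2) => refine (@computable_half _ _ _ f _)
  | |- computable _ (fun a => odd (@?f a)) => refine (@computable_odd _ _ _ f _)
  | |- computable _ (fun a => @?f a + @?g a) => refine (@computable_addn _ _ _ f g _ _)
  | |- computable _ (fun a => @?f a - @?g a) => refine (@computable_subn _ _ _ f g _ _)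
  | |- computable _ (fun a => @?f a * @?g a) => refine (@computable_muln _ _ _ f g _ _)
  | |- computable _ (fun a => @?f a ^ @?g a) => refine (@computable_expn _ _ _ f g _ _)
  | |- computable _ (fun a => @?f a <= @?g a) => refine (@computable_leq _ _ _ f g _ _)
  | |- computable _ (fun a => ~~ @?f a) => refine (@computable_negb _ _ _ f _)
  | |- computable _ (fun a => @?f a && @?g a) => refine (@computable_andb _ _ _ f g _ _)
  | |- computable _ (fun a => @?f a || @?g a) => refine (@computable_orb _ _ _ f g _ _)
  | |- computable _ (fun a => @?f a ==> @?g a) => refine (@computable_implyb _ _ _ f g _ _)
  | |- computable _ (fun a => @eq_op Datatypes_nat__canonical__eqtype_Equality (@?f a) (@?g a)) =>
      refine (@computable_eqn _ _ _ f g _ _)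
  | |- computable _ (fun a => find (@?P a) (iota 0 (@?n a))) =>
      refine (@computable_find _ _ _ n P _ _)
  | |- computable _ (fun a => has (@?P a) (iota 0 (@?n a))) =>
      refine (@computable_has _ _ _ n P _ _)
  | |- computable _ (fun a => all (@?P a) (iota 0 (@?n a))) =>
      refine (@computable_all _ _ _ n P _ _)
  | |- computable _ (fun a => @?b a :: @?f a) => refine (@computable_cons _ _ _ b f _ _)
  | |- computable _ (fun a => behead (@?f a)) => refine (@computable_behead _ _ _ f _)
  | |- computable _ (fun a => size (@?f a)) => refine (@computable_size _ _ _ f _)
  | |- computable _ (fun a => drop (@?n a) (@?f a)) => refine (@computable_drop _ _ _ n f _ _)
  | |- computable _ (fun a => nth false (@?f a) (@?n a)) =>
      refine (@computable_nth _ _ _ n f _ _)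
  | |- computable _ (fun a => mkseq (@?f a) (@?n a)) =>
      refine (@computable_mkseq _ _ _ n f _ _)
  end.

(** * Computations with a finite oracle *)

(* Output 0 means that no value is found; output v.+1 means that the value is v.
   Only minimization needs a time bound, and it uses the length of the oracle. *)
Fixpoint run (c : code) (t : seq bool) (n : nat) {struct c} : nat :=
  match c with
  | Zero => 1
  | Succ => n.+2
  | Fst => (nfst n).+1
  | Snd => (nsnd n).+1
  | Oracle => if n < size t then (nth false t n).+1 else 0
  | Pair f g => if (run f t n == 0) || (run g t n == 0) then 0
                else (npair (run f t n).-1 (run g t n).-1).+1
  | Comp f g => if run g t n == 0 then 0 else run f t (run g t n).-1
  | Prec f g =>
      iteri (nsnd n) (fun i y => if y == 0 then 0
                                 else run g t (npair (nfst n) (npair i y.-1)))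
            (run f t (nfst n))
  | Mu f => let k := find (fun k => run f t (npair n k) <= 1) (iota 0 (size t)) in
            if (k < size t) && (run f t (npair n k) == 1) then k.+1 else 0
  end.

Lemma computable_run X c : computable X (fun p : seq bool * nat => run c p.1 p.2).
Proof.
elim: c => [|||||f Hf g Hg|f Hf g Hg|f Hf g Hg|f Hf] /=; comp_auto.
Qed.

Lemma findE (P : pred nat) m k :
  (find P (iota 0 m) == k) && (k < m) = [&& k < m, P k & all (fun i => ~~ P i) (iota 0 k)].
Proof.
case: (ltnP k m) => hk; last by rewrite andbF.
rewrite andbT -(subnKC hk) addSnnS iotaD find_cat size_iota /= add0n.
case: hasP => [[i hi Pi]|hn].
  have h : has P (iota 0 k) by apply/hasP; exists i.
  have := h; rewrite has_find size_iota => /ltn_eqF ->.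
  by case: allP => [/(_ _ hi)|_]; rewrite ?Pi // andbF.
have -> : all (fun i => ~~ P i) (iota 0 k).
  by apply/allP => i hi; apply/negP => Pi; apply: hn; exists i.
by case: (P k); rewrite /= ?addn0 ?eqxx //; apply/eqP; lia.
Qed.

(** The search stops at the first [k] where [run f] is undefined (0) or has value 0 (1). It succeeds
    only in the second case, so all earlier values are defined and positive. *)
Lemma mu_runE f t n v :
  (run (Mu f) t n == v.+1) =
  [&& v < size t, run f t (npair n v) == 1 & all (fun k => 1 < run f t (npair n k)) (iota 0 v)].
Proof.
rewrite /=; set P := fun k => _ <= 1; set m := size t.
have := findE P m v; set k := find _ _.
have -> : all (fun i => ~~ P i) (iota 0 v) = all (fun k => 1 < run f t (npair n k)) (iota 0 v).
  by apply: eq_all => i; rewrite /P -ltnNge.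
case: (ltnP v m) => hv; last first.
  move=> _; case: ifP => // /andP[]; rewrite eqSS; lia.
rewrite andbT /= {1}/P => h.
case e: (run f t (npair n v) == 1) => /=; last first.
  case: ifP => // /andP[_ e']; rewrite eqSS; apply/eqP => kv; move: e'; rewrite kv e //.
move: h; rewrite (eqP e) /= => <-; case: ifP; first by rewrite eqSS.
by case: (k =P v) => // ->; rewrite hv e.
Qed.

Definition initial (X : nat -> bool) (t : seq bool) := t = mkseq X (size t).

Lemma initial_mkseq X k : initial X (mkseq X k).
Proof. by rewrite /initial size_mkseq. Qed.

Lemma run_sound X c t n v : initial X t -> run c t n = v.+1 -> eval X c n v.
Proof.
move=> ht; elim: c n v => [|||||f Hf g Hg|f Hf g Hg|f Hf g Hg|f Hf] n v.
1-4: by move=> /= [<-].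
- by rewrite /= ht size_mkseq; case: ltnP => // h [<-]; rewrite nth_mkseq.
- move=> /=; case ef: (run f t n) => [|a] //=; case eg: (run g t n) => [|b] //= [<-].
  by exists a, b; split; auto.
- by move=> /=; case eg: (run g t n) => [|b] //= /Hf ef; exists b; auto.
- rewrite -(npair_eta n) /= nfst_pair nsnd_pair.
  elim: (nsnd n) v => [|m IH] v /=; first by auto.
  set y := iteri _ _ _ in IH *; case ey: y => [|u] //= /Hg h.
  by exists u => //; apply: IH.
- move/eqP; rewrite mu_runE => /and3P[_ /eqP/Hf h /allP ha]; split=> // k hk.
  have := ha k; rewrite mem_iota => /(_ hk).
  by case e: run => [|[|u]] // _; exists u; apply: Hf.
Qed.

(** A longer oracle answers old queries as before and only lengthens searches. A minimum found stays
    the minimum, because the values before it are defined already and persist. *)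
Lemma run_mono c t t' n v : prefix t t' -> run c t n = v.+1 -> run c t' n = v.+1.
Proof.
move=> /prefixP[r ->]; elim: c n v => [|||||f Hf g Hg|f Hf g Hg|f Hf g Hg|f Hf] n v //.
- by rewrite /= size_cat nth_cat; case: ltnP => // h; rewrite ltn_addr.
- move=> /=; case ef: (run f t n) => [|a] //=; case eg: (run g t n) => [|b] //= <-.
  by rewrite (Hf _ _ ef) (Hg _ _ eg).
- by move=> /=; case eg: (run g t n) => [|b] //= /Hf <-; rewrite (Hg _ _ eg).
- move=> /=; elim: (nsnd n) v => [|m IH] v /=; first by auto.
  set y := iteri _ _ _ in IH *; case ey: y => [|u] //= /Hg h.
  by rewrite (IH _ ey).
- move/eqP; rewrite mu_runE => /and3P[hv /eqP/Hf h /allP ha]; apply/eqP; rewrite mu_runE h eqxx.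
  rewrite size_cat ltn_addr //=; apply/allP => k /ha.
  by case e: (run f t _) => [|[|u]] // _; rewrite (Hf _ _ e).
Qed.

Lemma prefix_mkseq (X : nat -> bool) k m : k <= m -> prefix (mkseq X k) (mkseq X m).
Proof.
by move=> h; apply/prefixP; exists (map X (iota k (m - k))); rewrite /mkseq -map_cat -iotaD subnKC.
Qed.

Lemma eventually_all (P : nat -> nat -> Prop) m :
  (forall k, k < m -> exists r0, forall r, r0 <= r -> P k r) ->
  exists r0, forall r, r0 <= r -> forall k, k < m -> P k r.
Proof.
elim: m => [|m IH] h; first by exists 0.
have [r1 h1] := IH (fun k hk => h k (ltnW hk)); have [r2 h2] := h m (ltnSn m).
exists (maxn r1 r2) => r; rewrite geq_max => /andP[hr1 hr2] k; rewrite ltnS leq_eqVlt.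
by case/orP => [/eqP->|]; auto.
Qed.

(** A halting computation makes finitely many queries and bounded searches; any initial segment
    beyond all of them suffices. *)
Lemma run_complete X c n v :
  eval X c n v -> exists s0, forall s, s0 <= s -> run c (mkseq X s) n = v.+1.
Proof.
elim: c n v => [|||||f Hf g Hg|f Hf g Hg|f Hf g Hg|f Hf] n v; try by move=> /= ->; exists 0.
- by move=> /= ->; exists n.+1 => s hs; rewrite size_mkseq hs nth_mkseq.
- move=> [a [b [/Hf [s1 h1] /Hg [s2 h2] ->]]]; exists (maxn s1 s2) => s.
  by rewrite geq_max => /andP[hs1 hs2] /=; rewrite h1 // h2.
- move=> [a /Hg [s1 h1] /Hf [s2 h2]]; exists (maxn s1 s2) => s.
  by rewrite geq_max => /andP[hs1 hs2] /=; rewrite h1 //= h2.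
- rewrite -(npair_eta n); elim: (nsnd n) v => [|m IH] v.
    by rewrite eval_prec0 ?nfst_pair ?nsnd_pair //= nfst_pair nsnd_pair => /Hf.
  rewrite eval_precS => -[u /IH [s1 h1] /Hg [s2 h2]]; exists (maxn s1 s2) => s.
  rewrite geq_max => /andP[hs1 hs2] /=; have := h1 s hs1; have := h2 s hs2.
  by rewrite /= !nfst_pair !nsnd_pair /= => h2' ->.
- move=> [/Hf [s1 h1] hk].
  have [s2 h2] : exists s2, forall s, s2 <= s -> forall k, k < v -> 1 < run f (mkseq X s) (npair n k).
    apply: (@eventually_all (fun k s => 1 < run f (mkseq X s) (npair n k))) => k /hk [u /Hf [s0 h0]].
    by exists s0 => s /h0 ->.
  exists (maxn v.+1 (maxn s1 s2)) => s; rewrite !geq_max => /and3P[hs0 hs1 hs2]; apply/eqP.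
  rewrite mu_runE size_mkseq hs0 h1 //=; apply/allP => k; rewrite mem_iota => /= hkv.
  exact: h2.
Qed.

(** * Certificates of halting *)

(* A certificate is a finite set of claims, coded by its characteristic string:
   that e is the number of a program (tag 0), and that program e maps n to v (tag 1).
   Every claim must follow from others in the set by one evaluation rule. No ordering of
   the claims is needed: each rule goes to subprograms, or to the same program
   with a smaller recursion argument, so there is no circularity. *)
Definition isW (D : seq bool) (e : nat) : bool := nth false D (npair 0 e).
Definition isE (D : seq bool) (e n v : nat) : bool :=
  nth false D (npair 1 (npair e (npair n v))).

Definition ruleW (D : seq bool) (e : nat) : bool :=
  if nfst e <= 4 then nsnd e == 0
  else if nfst e <= 7 then isW D (nfst (nsnd e)) && isW D (nsnd (nsnd e))
  else (nfst e == 8) && isW D (nsnd e).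

(** The cases follow the tags of [gnum], and tag 4 gives 0 because the oracle is empty. Larger tags
    than 7 are all read as [Mu]; the claim [isW D e] in [certificate] ensures that [e] is a genuine
    program number. *)
Definition ruleE (D : seq bool) (e n v : nat) : bool :=
  let f := nfst (nsnd e) in
  let g := nsnd (nsnd e) in
  if nfst e == 0 then v == 0
  else if nfst e == 1 then v == n.+1
  else if nfst e == 2 then v == nfst n
  else if nfst e == 3 then v == nsnd n
  else if nfst e == 4 then v == 0
  else if nfst e == 5 then isE D f n (nfst v) && isE D g n (nsnd v)
  else if nfst e == 6 then has (fun a => isE D g n a && isE D f a v) (iota 0 (size D))
  else if nfst e == 7 then
    if nsnd n == 0 then isE D f (nfst n) v
    else has (fun u => isE D e (npair (nfst n) (nsnd n).-1) u &&
                       isE D g (npair (nfst n) (npair (nsnd n).-1 u)) v) (iota 0 (size D))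
  else isE D (nsnd e) (npair n v) 0 &&
       all (fun k => has (fun u => isE D (nsnd e) (npair n k) u.+1) (iota 0 (size D))) (iota 0 v).

Definition rule (D : seq bool) (x : nat) : bool :=
  let y := nsnd x in
  if nfst x == 0 then ruleW D y else ruleE D (nfst y) (nfst (nsnd y)) (nsnd (nsnd y)).

Definition closed (D : seq bool) : bool :=
  all (fun x => nth false D x ==> rule D x) (iota 0 (size D)).

Definition certificate (e : nat) (D : seq bool) : bool :=
  [&& closed D, isW D e & has (fun v => isE D e e v) (iota 0 (size D))].

Lemma computable_certificate X : computable X (fun p : nat * seq bool => certificate p.1 p.2).
Proof.
rewrite /certificate /closed /rule /ruleW /ruleE /isW /isE; comp_auto.
Qed.

Lemma nth_lt_size (D : seq bool) x : nth false D x -> x < size D.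
Proof. by case: ltnP => // h; rewrite nth_default. Qed.

(** The pairing dominates its components, so a claimed value is below the index of its claim. This
    justifies the bound [size D] on the intermediate values in [ruleE]. *)
Lemma isE_lt D e n v : isE D e n v -> v < size D.
Proof.
move/nth_lt_size; apply: leq_ltn_trans.
by do 3!(apply: leq_trans (leq_npairr _ _)).
Qed.

Lemma hasE_iota (D : seq bool) (Q : pred nat) :
  (forall v, Q v -> v < size D) ->
  reflect (exists v, Q v) (has Q (iota 0 (size D))).
Proof.
move=> h; apply: (iffP hasP) => [[v _ Qv]|[v Qv]]; first by exists v.
by exists v => //; rewrite mem_iota h.
Qed.

Lemma closedP D : reflect (forall x, nth false D x -> rule D x) (closed D).
Proof.
apply: (iffP allP) => h x; last by move=> _; apply/implyP/h.
by move=> hx; apply: (implyP (h x _)) => //; rewrite mem_iota /= nth_lt_size.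
Qed.

(** Strong induction on [e]: when the tag is positive, [nsnd e] and its components are smaller than
    [e]. *)
Lemma closed_isW D e : closed D -> isW D e -> exists c, e = gnum c.
Proof.
move=> /closedP hD; elim/ltn_ind: e => e IH /hD.
rewrite /rule nfst_pair nsnd_pair /= /ruleW.
have he := npair_eta e; have he' := npair_eta (nsnd e).
have hlt : 0 < nfst e -> nsnd e < e by move=> h; rewrite -{2}he ltn_npairr.
have hl : nfst (nsnd e) <= nsnd e by rewrite -{2}he' leq_npairl.
have hr : nsnd (nsnd e) <= nsnd e by rewrite -{2}he' leq_npairr.
case ek: (nfst e) he hlt => [|k] he hlt.
  by move=> /eqP h0; exists Zero; rewrite -he h0.
have {}hlt := hlt isT.
case: (ltnP k 4) => hk.
  move=> /eqP h0; rewrite -he h0 {he ek}.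
  case: k hk => [|[|[|[|k]]]] // _; by [exists Succ|exists Fst|exists Snd|exists Oracle].
case: (ltnP k 7) => hk7.
  move=> /andP[/IH[|f ef]]; first lia.
  move=> /IH[|g eg]; first lia.
  rewrite -he -he' ef eg {he ek}.
  case: k hk hk7 => [|[|[|[|[|[|[|k]]]]]]] // _ _;
    by [exists (Pair f g)|exists (Comp f g)|exists (Prec f g)].
move=> /andP[/eqP k8 /IH[|f ef]]; first lia.
by exists (Mu f); rewrite -he k8 ef.
Qed.

Lemma closed_isE D c n v : closed D -> isE D (gnum c) n v -> eval emptyset c n v.
Proof.
move=> /closedP hD.
have hE e n' v' : isE D e n' v' -> ruleE D e n' v'.
  by move=> /hD; rewrite /rule !(nfst_pair, nsnd_pair).
elim: c n v => [|||||f Hf g Hg|f Hf g Hg|f Hf g Hg|f Hf] n v.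
1-5: by move=> /hE; rewrite /ruleE !(nfst_pair, nsnd_pair) /= => /eqP.
- move=> /hE; rewrite /ruleE /= !(nfst_pair, nsnd_pair) => /andP[/Hf h1 /Hg h2].
  by exists (nfst v), (nsnd v); rewrite npair_eta.
- move=> /hE; rewrite /ruleE /= !(nfst_pair, nsnd_pair) => /hasP[a _ /andP[/Hg h1 /Hf h2]].
  by exists a.
- rewrite -(npair_eta n); elim: (nsnd n) v => [|m IH] v /hE;
    rewrite /ruleE /= !(nfst_pair, nsnd_pair) //=; first exact: Hf.
  move=> /hasP[u _ /andP[/IH + /Hg h2]]; rewrite /= nfst_pair nsnd_pair.
  by exists u.
- move=> /hE; rewrite /ruleE /= !(nfst_pair, nsnd_pair) => /andP[/Hf h1 /allP h2].
  split=> // k hk; have := h2 k; rewrite mem_iota => /(_ hk) /hasP[u _ /Hf]; by exists u.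
Qed.

(** * Completeness: every halting computation has a certificate *)

Definition extends (D D' : seq bool) :=
  forall x, nth false D x -> nth false D' x.

Lemma hasE_extends (D D' : seq bool) (P P' : pred nat) :
  (forall v, P v -> P' v) -> (forall v, P' v -> v < size D') ->
  has P (iota 0 (size D)) -> has P' (iota 0 (size D')).
Proof. by move=> h h' /hasP[v _ /h Pv]; apply/hasE_iota => //; exists v. Qed.

(** Claims occur only positively in the rules, and [isE_lt] keeps every witness within the new
    search bound. *)
Lemma rule_extends D D' x : extends D D' -> rule D x -> rule D' x.
Proof.
move=> h; have hW e : isW D e -> isW D' e by apply: h.
have hE e n v : isE D e n v -> isE D' e n v by apply: h.
rewrite /rule; case: eqP => _.
  rewrite /ruleW; do 2![case: ifP => // _]; first by move=> /andP[/hW -> /hW].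
  by move=> /andP[-> /hW].
move: (nfst (nsnd x)) (nfst (nsnd (nsnd x))) (nsnd (nsnd (nsnd x))) => e n v.
rewrite /ruleE; do 5![case: ifP => // _].
case: ifP => _; first by move=> /andP[/hE -> /hE].
case: ifP => _.
  apply: hasE_extends => u /andP[h1 h2]; last exact: isE_lt h1.
  by rewrite !hE.
case: ifP => _.
  case: ifP => _; first exact: hE.
  apply: hasE_extends => u /andP[h1 h2]; last exact: isE_lt h1.
  by rewrite !hE.
move=> /andP[/hE -> /allP h1]; apply/allP => k /h1.
by apply: hasE_extends => u; [apply: hE|move=> /isE_lt/ltnW].
Qed.

Lemma nth_mkseqb (Q : pred nat) m x : nth false (mkseq Q m) x = (x < m) && Q x.
Proof. by case: ltnP => h; [rewrite nth_mkseq|rewrite nth_default ?size_mkseq]. Qed.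

Lemma closed_add D x : closed D -> rule D x ->
  exists D', [/\ closed D', extends D D' & nth false D' x].
Proof.
move=> /closedP hD hx.
pose D' := mkseq (fun y => nth false D y || (y == x)) (maxn (size D) x.+1).
have hext : extends D D'.
  by move=> y hy; rewrite nth_mkseqb hy leq_max nth_lt_size.
exists D'; split=> //; last by rewrite nth_mkseqb eqxx orbT andbT leq_max ltnSn orbT.
apply/closedP => y; rewrite nth_mkseqb => /andP[_] /orP[/hD|/eqP->];
  exact: (rule_extends hext).
Qed.

Lemma closed_join D1 D2 : closed D1 -> closed D2 ->
  exists D', [/\ closed D', extends D1 D' & extends D2 D'].
Proof.
move=> /closedP h1 /closedP h2.
pose D' := mkseq (fun y => nth false D1 y || nth false D2 y) (maxn (size D1) (size D2)).
have e1 : extends D1 D' by move=> y hy; rewrite nth_mkseqb hy leq_max nth_lt_size.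
have e2 : extends D2 D' by move=> y hy; rewrite nth_mkseqb hy orbT andbT leq_max (nth_lt_size hy) orbT.
exists D'; split=> //; apply/closedP => y; rewrite nth_mkseqb => /andP[_] /orP[/h1|/h2].
  exact: (rule_extends e1).
exact: (rule_extends e2).
Qed.

Definition derivable (P : seq bool -> Prop) := exists2 D, closed D & P D.

Lemma derivable_and (P Q : seq bool -> Prop) :
  (forall D D', extends D D' -> P D -> P D') -> (forall D D', extends D D' -> Q D -> Q D') ->
  derivable P -> derivable Q -> derivable (fun D => P D /\ Q D).
Proof.
move=> hP hQ [D1 c1 p] [D2 c2 q]; have [D [c e1 e2]] := closed_join c1 c2.
by exists D => //; split; [apply: hP e1 p|apply: hQ e2 q].
Qed.

Lemma derivable_rule (P : seq bool -> Prop) x :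
  (forall D, P D -> rule D x) -> derivable P -> derivable (fun D => nth false D x).
Proof.
by move=> h [D cD /h hx]; have [D' [cD' _ hx']] := closed_add cD hx; exists D'.
Qed.

Lemma derivable_isW c : derivable (isW^~ (gnum c)).
Proof.
have ext e D D' : extends D D' -> isW D e -> isW D' e by apply.
have nilD : derivable (fun=> True) by exists [::].
have bin k f g : 4 < k <= 7 -> derivable (isW^~ f) -> derivable (isW^~ g) ->
    derivable (isW^~ (npair k (npair f g))).
  move=> hk hf hg; apply: derivable_rule (derivable_and (@ext f) (@ext g) hf hg).
  move=> D [h1 h2]; rewrite /rule /ruleW !(nfst_pair, nsnd_pair) /= h1 h2.
  by rewrite [k <= 4]leqNgt; case/andP: hk => -> ->.
elim: c => [|||||f Hf g Hg|f Hf g Hg|f Hf g Hg|f Hf]; try exact: bin.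
1-5: by apply: derivable_rule nilD => D _; rewrite /rule /ruleW !(nfst_pair, nsnd_pair).
by apply: derivable_rule Hf => D h; rewrite /rule /ruleW !(nfst_pair, nsnd_pair).
Qed.

Lemma derivable_isE c n v : eval emptyset c n v -> derivable (fun D => isE D (gnum c) n v).
Proof.
have ext e n' v' D D' : extends D D' -> isE D e n' v' -> isE D' e n' v' by apply.
have nilD : derivable (fun=> True) by exists [::].
elim: c n v => [|||||f Hf g Hg|f Hf g Hg|f Hf g Hg|f Hf] n v.
1-5: by move=> /= e; apply: derivable_rule nilD => D _; rewrite /rule /ruleE
    !(nfst_pair, nsnd_pair) e /= eqxx.
- move=> [a [b [/Hf ha /Hg hb ->]]]; apply: derivable_rule (derivable_and _ _ ha hb).
  2-3: by apply: ext.
  by move=> D [h1 h2]; rewrite /rule /ruleE /= !(nfst_pair, nsnd_pair) h1 h2.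
- move=> [a /Hg ha /Hf hb]; apply: derivable_rule (derivable_and _ _ ha hb).
  2-3: by apply: ext.
  move=> D [h1 h2]; rewrite /rule /ruleE /= !(nfst_pair, nsnd_pair) /=.
  by apply/hasP; exists a; rewrite ?h1 ?h2 // mem_iota (isE_lt h1).
- rewrite -(npair_eta n); elim: (nsnd n) v => [|m IH] v.
    rewrite eval_prec0 ?nfst_pair ?nsnd_pair // => /Hf h; apply: derivable_rule h => D h.
    by rewrite /rule /ruleE /= !(nfst_pair, nsnd_pair).
  rewrite eval_precS => -[u /IH ha /Hg hb]; apply: derivable_rule (derivable_and _ _ ha hb).
  2-3: by apply: ext.
  move=> D [h1 h2]; rewrite /rule /ruleE /= !(nfst_pair, nsnd_pair) /=.
  by apply/hasP; exists u; rewrite ?h1 ?h2 // mem_iota (isE_lt h1).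
- move=> [/Hf h0 hk].
  (* The claims for all [k < v] must lie in one closed set, which is built by joining one claim at a
     time. *)
  have h1 : derivable (fun D => forall k, k < v -> exists u, isE D (gnum f) (npair n k) u.+1).
    elim: {h0} v hk => [|v IH] hk; first by exists [::].
    have {}IH := IH (fun k hkv => hk k (ltnW hkv)); have [u /Hf hu] := hk v (ltnSn v).
    have [|D cD [p q]] := derivable_and _ (@ext _ _ _) IH hu.
      by move=> D D' e h k /h [w hw]; exists w; apply: ext e hw.
    exists D => // k; rewrite ltnS leq_eqVlt => /orP[/eqP->|/p //]; by exists u.
  apply: derivable_rule (derivable_and (@ext _ _ _) _ h0 h1); last first.
    by move=> D D' e h k /h [w hw]; exists w; apply: ext e hw.
  move=> D [p q]; rewrite /rule /ruleE /= !(nfst_pair, nsnd_pair) p /=.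
  apply/allP => k; rewrite mem_iota /= => /q [u hu]; apply/hasP; exists u => //.
  by rewrite mem_iota; have := isE_lt hu; lia.
Qed.

(** Halting becomes the existence of an object with a computable check; this takes the place of a
    universal program. *)
Lemma halting_certificate e : halting_problem e <-> exists D, certificate e D.
Proof.
split=> [[c [-> [v /derivable_isE hE]]]|[D /and3P[cD hW /hasP[v _ hE]]]].
  have [||D cD [hD1 hD2]] := derivable_and _ _ (derivable_isW c) hE; try by move=> D D'; apply.
  by exists D; rewrite /certificate cD hD1; apply/hasP; exists v; rewrite ?mem_iota ?(isE_lt hD2).
have [c ec] := closed_isW cD hW; exists c; split=> //; exists v.
by apply: closed_isE cD _; rewrite -ec.
Qed.

(** * The greedy enumeration *)

(* The binary digits of i, least significant first, so that extending a string of
   length L by a bit b adds b * 2^L to its index. *)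
Definition bits (L i : nat) : seq bool := mkseq (fun k => odd (iter k half i)) L.

Lemma computable_bits X : computable X (fun p : nat * nat => bits p.1 p.2).
Proof.
apply: (@computable_ext _ _ _ _ _
  (fun p => mkseq (fun k => odd (iteri k (fun _ => half) p.2)) p.1)).
  by move=> p; apply: eq_map => k; congr odd; elim: k => //= k ->.
by comp_auto.
Qed.

Lemma size_bits L i : size (bits L i) = L.
Proof. exact: size_mkseq. Qed.

Lemma iter_half k i : iter k half i = i %/ 2 ^ k.
Proof. by elim: k => [|k IH] /=; rewrite ?divn1 // IH -divn2 -divnMA expnSr. Qed.

Lemma bits_rcons L i (b : bool) : i < 2 ^ L -> bits L.+1 (b * 2 ^ L + i) = rcons (bits L i) b.
Proof.
move=> hi; rewrite /bits mkseqS; congr rcons.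
  apply/eq_in_map => k; rewrite mem_iota add0n /= => hk; rewrite !iter_half.
  (* For [k < L] the term b 2^L divided by 2^k is even, so it does not affect digit [k]. *)
  have -> : 2 ^ L = 2 ^ (L - k.+1) * 2 * 2 ^ k by rewrite -mulnA -expnS -expnD subnK.
  by rewrite !mulnA divnMDl ?expn_gt0 // oddD muln2 odd_double.
by rewrite iter_half divnMDl ?expn_gt0 // divn_small // addn0 oddb.
Qed.

Lemma bits_surj s : exists2 i, i < 2 ^ size s & bits (size s) i = s.
Proof.
elim/last_ind: s => [|s b [i hi es]]; first by exists 0.
exists (b * 2 ^ size s + i); last by rewrite size_rcons bits_rcons // es.
by rewrite size_rcons expnS; case: b; lia.
Qed.

(** * Counting strings of a given length *)

Definition cnt (L : nat) (P : pred (seq bool)) : nat := \sum_(i < 2 ^ L) P (bits L i).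

Lemma cntS L P :
  cnt L.+1 P = cnt L (fun s => P (rcons s false)) + cnt L (fun s => P (rcons s true)).
Proof.
rewrite /cnt expnS mul2n -addnn big_split_ord /=; congr (_ + _); apply: eq_bigr => i _.
  by rewrite -bits_rcons.
by rewrite -bits_rcons // mul1n.
Qed.

Lemma eq_cnt L (P Q : pred (seq bool)) : (forall s, size s = L -> P s = Q s) -> cnt L P = cnt L Q.
Proof. by move=> h; apply: eq_bigr => i _; rewrite h ?size_bits. Qed.

Lemma leq_cnt L (P Q : pred (seq bool)) : (forall s, size s = L -> P s -> Q s) -> cnt L P <= cnt L Q.
Proof.
move=> h; apply: leq_sum => i _; have := h _ (size_bits L i).
by case: (P _) => // ->.
Qed.

Lemma cnt_le L P : cnt L P <= 2 ^ L.
Proof.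
apply: (@leq_trans (\sum_(i < 2 ^ L) 1)); last by rewrite sum1_card card_ord.
by apply: leq_sum => i _; case: (P _).
Qed.

(** Each string has 2^(M-L) extensions of length [M], so the measure of a property closed under
    extension cannot decrease. *)
Lemma cnt_extend L M (P : pred (seq bool)) :
  (forall s b, P s -> P (rcons s b)) -> L <= M -> cnt L P * 2 ^ (M - L) <= cnt M P.
Proof.
move=> hP; elim: M => [|M IH]; first by rewrite leqn0 => /eqP->; rewrite muln1.
rewrite leq_eqVlt => /orP[/eqP <-|hM]; first by rewrite subnn muln1.
rewrite subSn // expnSr mulnA muln2 -addnn cntS; have {}IH := IH hM.
by apply: leq_add; apply: leq_trans IH _; apply: leq_cnt => s _; apply: hP.
Qed.

(** Links the computable count over indices with the cardinalities used in [proper_tree] and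
    [open_measure_le]. *)
Lemma card_cnt N (P : pred (seq bool)) : #|[set t : N.-tuple bool | P t]| = cnt N P.
Proof.
have h (t : N.-tuple bool) : exists i : 'I_(2 ^ N), bits N i == t.
  have [i hi e] := bits_surj t; rewrite size_tuple in hi e.
  by exists (Ordinal hi); rewrite e.
pose g t := xchoose (h t); have gK t : bits N (g t) = t by apply/eqP/(xchooseP (h t)).
have ginj : injective g by move=> t u e; apply: val_inj; rewrite /= -gK e gK.
have gbij : bijective g.
  by apply: inj_card_bij => //; rewrite card_ord card_tuple card_bool.
rewrite /cnt (reindex g) /=; last exact: onW_bij.
rewrite cardsE -sum1_card big_mkcond; apply: eq_bigr => t _; rewrite gK unfold_in.
by case: (P t).
Qed.

(** As [run] shifts values by one, 2 stands for the output 1, the answer yes. *)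
Definition accepts (c : code) (t s : seq bool) : bool := run c t (str_num s) == 2.

Lemma computable_accepts X c : computable X (fun p : seq bool * seq bool => accepts c p.1 p.2).
Proof. by have := computable_run X c; rewrite /accepts => h; comp_auto. Qed.

Lemma accepts_prefix c t t' s : prefix t t' -> accepts c t s -> accepts c t' s.
Proof. by move=> h /eqP e; apply/eqP; apply: run_mono h e. Qed.

(* Sets of strings of length L are coded by a characteristic string F of length
   2^L, indexed as in [bits]. *)
Definition wide c n L t := 2 ^ (4 * n + 2) <= cnt L (accepts c t).
Definition hits c L F t := has (fun i => nth false F i && accepts c t (bits L i)) (iota 0 (2 ^ L)).
Definition missed c n L F t := wide c n L t && ~~ hits c L F t.
(** Divided by 2^s, this is the measure of the missed oracles that accept string [i]; [elect]
    compares it with 2^(2n-L), cleared of denominators. *)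
Definition votes c n L F s i := cnt s (fun t => missed c n L F t && accepts c t (bits L i)).
(* The value is at least 2^L when no string qualifies. *)
Definition elect c n L F s :=
  find (fun i => 2 ^ (2 * n + s) <= votes c n L F s i * 2 ^ L) (iota 0 (2 ^ L)).
(** At a quiet stage [elect] returns 2^L, which is no valid index, so the set stays the same. *)
Definition greedy c n L s : seq bool :=
  iteri s (fun r F => mkseq (fun j => nth false F j || (j == elect c n L F r)) (2 ^ L)) [::].
Definition quiet c n L s := 2 ^ L <= elect c n L (greedy c n L s) s.

Definition ones L (F : seq bool) := \sum_(i < 2 ^ L) nth false F i.

Section Greedy.
Context (c : code) (n L : nat).
Local Notation hits := (hits c L).
Local Notation missed := (missed c n L).
Local Notation votes := (votes c n L).
Local Notation elect := (elect c n L).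
Local Notation greedy := (greedy c n L).
Local Notation quiet := (quiet c n L).
Local Notation ones := (ones L).

Lemma hits_prefix F t t' : prefix t t' -> hits F t -> hits F t'.
Proof.
move=> h; apply: sub_has => i /andP[-> /=]; exact: accepts_prefix.
Qed.

(** The elected string is new: a missed oracle accepts no member of [F], so a member of [F] would
    receive no votes. *)
Lemma electP F s : elect F s < 2 ^ L ->
  [/\ 2 ^ (2 * n + s) <= votes F s (elect F s) * 2 ^ L & nth false F (elect F s) = false].
Proof.
move=> h; set i := elect F s.
have hi : 2 ^ (2 * n + s) <= votes F s i * 2 ^ L.
  have hh : has (fun i => 2 ^ (2 * n + s) <= votes F s i * 2 ^ L) (iota 0 (2 ^ L)).
    by rewrite has_find size_iota.
  by have := nth_find 0 hh; rewrite nth_iota // add0n.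
split=> //; apply/negbTE/negP => hF.
suff e : votes F s i = 0 by move: hi; rewrite e leqn0 expn_eq0.
apply: big1 => j _; apply/eqP; rewrite eqb0; apply/negP => /andP[/andP[_ /hasPn hn] ha].
by have := hn i; rewrite mem_iota hF ha => /(_ h).
Qed.

Lemma greedyS s j :
  nth false (greedy s.+1) j = (j < 2 ^ L) && (nth false (greedy s) j || (j == elect (greedy s) s)).
Proof. by rewrite nth_mkseqb. Qed.

Lemma ones_quiet s : quiet s -> ones (greedy s.+1) = ones (greedy s).
Proof.
rewrite /quiet => h; apply: eq_bigr => i _; rewrite greedyS ltn_ord /=.
by case: eqP => [e|]; rewrite ?orbF //; have := ltn_ord i; lia.
Qed.

Lemma ones_elect s : ~~ quiet s -> ones (greedy s.+1) = (ones (greedy s)).+1.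
Proof.
rewrite /quiet -ltnNge => h; have [_ hF] := electP h.
rewrite /ones (bigD1 (Ordinal h)) //= [in RHS](bigD1 (Ordinal h)) //=.
rewrite greedyS h hF eqxx add1n add0n; congr _.+1.
apply: eq_bigr => i; rewrite -val_eqE /= => /negbTE hi.
by rewrite greedyS ltn_ord hi orbF.
Qed.

(** The oracles voting for the elected string are not hit before the stage and are hit after it, so
    the two counts on the left are of disjoint sets. *)
Lemma cover_elect s : ~~ quiet s ->
  cnt s (hits (greedy s)) + votes (greedy s) s (elect (greedy s) s) <= cnt s (hits (greedy s.+1)).
Proof.
rewrite /quiet -ltnNge => h; rewrite -big_split /=; apply: leq_sum => i _.
set t := bits s i; case: (boolP (hits _ t)) => ht.
  rewrite /missed ht andbF addn0.
  suff -> : hits (greedy s.+1) t by [].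
  case/hasP: ht => j hj /andP[hF ha]; apply/hasP; exists j => //.
  by move: hj; rewrite mem_iota greedyS hF ha /= add0n => ->.
case: andP => // -[_ ha]; suff -> : hits (greedy s.+1) t by [].
by apply/hasP; exists (elect (greedy s) s); rewrite ?mem_iota // greedyS h eqxx orbT.
Qed.

Lemma cover_quiet s : cnt s (hits (greedy s)) <= cnt s (hits (greedy s.+1)).
Proof.
apply: leq_cnt => t _ /hasP[j hj /andP[hF ha]]; apply/hasP; exists j => //.
by move: hj; rewrite mem_iota greedyS hF ha /= add0n => ->.
Qed.

Lemma cover_double F s : cnt s (hits F) * 2 <= cnt s.+1 (hits F).
Proof.
have := @cnt_extend s s.+1 (hits F); rewrite subSnn; apply=> // t b.
by apply: hits_prefix; rewrite -cats1 prefix_prefix.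
Qed.

(** Invariant: the hit oracles have measure at least 2^(2n-L) per enumerated string. An election
    adds that much by [cover_elect], and passing to longer oracles loses nothing. *)
Lemma ones_cover s : ones (greedy s) * 2 ^ (2 * n + s) <= 2 ^ L * cnt s (hits (greedy s)).
Proof.
elim: s => [|s IH].
  by rewrite /ones big1 // => i _; rewrite nth_nil.
apply: leq_trans (_ : 2 ^ L * (cnt s (hits (greedy s.+1)) * 2) <= _); last first.
  by rewrite leq_mul2l cover_double orbT.
rewrite addnS expnSr !mulnA leq_mul2r /=.
case: (boolP (quiet s)) => hq.
  rewrite ones_quiet //; apply: leq_trans IH _; rewrite leq_mul2l orbC.
  by rewrite cover_quiet.
rewrite ones_elect // mulSn addnC; apply: leq_trans _ (leq_mul (leqnn _) (cover_elect hq)).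
rewrite mulnDr; apply: leq_add => //.
move: hq; rewrite /quiet -ltnNge => /electP[h _]; by rewrite [leqRHS]mulnC.
Qed.

Lemma ones_le s : ones (greedy s) * 2 ^ (2 * n) <= 2 ^ L.
Proof.
have := leq_trans (ones_cover s) (leq_mul (leqnn _) (cnt_le _ _)).
by rewrite expnD mulnA leq_pmul2r ?expn_gt0.
Qed.

(** Double counting of pairs of a missed oracle and a string it accepts: each oracle lies in at
    least 2^(4n+2) pairs, each of the 2^L strings in at most 2^(2n+s-L). *)
Lemma quiet_missed s : quiet s -> cnt s (missed (greedy s)) * 2 ^ (2 * n + 2) <= 2 ^ s.
Proof.
rewrite /quiet; set F := greedy s => hq.
have hv i : i < 2 ^ L -> votes F s i * 2 ^ L <= 2 ^ (2 * n + s).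
  move=> hi; rewrite leqNgt; apply/negP => h.
  have := @before_find _ 0 (fun i => 2 ^ (2 * n + s) <= votes F s i * 2 ^ L) (iota 0 (2 ^ L)) i.
  by rewrite nth_iota // add0n (ltnW h) => /(_ (leq_trans hi hq)).
have h1 : (\sum_(i < 2 ^ L) votes F s i) * 2 ^ L <= 2 ^ (2 * n + s) * 2 ^ L.
  rewrite big_distrl /= [leqRHS]mulnC -[X in X * _](card_ord (2 ^ L)) -sum_nat_const.
  by apply: leq_sum => i _; apply: hv.
rewrite leq_pmul2r ?expn_gt0 // in h1.
have h2 : cnt s (missed F) * 2 ^ (4 * n + 2) <= \sum_(i < 2 ^ L) votes F s i.
  rewrite /votes exchange_big big_distrl /=; apply: leq_sum => j _.
  case: (boolP (missed F _)) => //= /andP[hw _]; rewrite mul1n; exact: hw.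
have := leq_trans h2 h1.
have -> : 4 * n + 2 = 2 * n + 2 + 2 * n by lia.
by rewrite [2 * n + s]addnC !(expnD 2 _ (2 * n)) mulnA leq_pmul2r ?expn_gt0.
Qed.

(** Otherwise every stage from [s] on enumerates a new string, against the bound [ones_le]. *)
Lemma exists_quiet s : exists2 r, s <= r & quiet r.
Proof.
apply: NNPP => hn.
have hq r : s <= r -> ~~ quiet r by move=> hr; apply/negP => h; apply: hn; exists r.
have hk k : k <= ones (greedy (s + k)).
  by elim: k => // k IH; rewrite addnS ones_elect ?hq ?leq_addr.
have := ones_le (s + (2 ^ L).+1); have := hk (2 ^ L).+1.
move: (ones _) => x hx hx'; have := leq_trans hx (leq_trans (leq_pmulr x _) hx').
by rewrite ltnn expn_gt0 => /(_ isT).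
Qed.

Lemma greedy_elect s i : nth false (greedy s) i ->
  exists r, ~~ quiet r /\ elect (greedy r) r = i.
Proof.
elim: s => [|s IH]; first by rewrite nth_nil.
rewrite greedyS => /andP[hi /orP[/IH //|/eqP e]]; exists s; split=> //.
by rewrite /quiet -ltnNge -e.
Qed.

Lemma ones_mono r s : r <= s -> ones (greedy r) <= ones (greedy s).
Proof.
elim: s => [|s IH]; first by rewrite leqn0 => /eqP->.
rewrite leq_eqVlt => /orP[/eqP->//|/IH h]; apply: leq_trans h _.
by case: (boolP (quiet s)) => hq; [rewrite ones_quiet|rewrite ones_elect].
Qed.

(** Each election increases the count, so the count before an election identifies its stage. It
    serves as the index of the elected string. *)
Lemma ones_inj r s : ~~ quiet r -> ~~ quiet s -> ones (greedy r) = ones (greedy s) -> r = s.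
Proof.
move=> hr hs e; case: (ltngtP r s) => // /ones_mono.
  by rewrite ones_elect // e ltnn.
by rewrite ones_elect // e ltnn.
Qed.

(** [ones_le] one stage later, with the new string included, shows that the index fits into L-2n
    bits. *)
Lemma ones_lt s : ~~ quiet s -> 2 * n <= L /\ ones (greedy s) < 2 ^ (L - 2 * n).
Proof.
move=> hq; have := ones_le s.+1; rewrite ones_elect // => h.
have hL : 2 * n <= L.
  by rewrite -(@leq_exp2l 2) //; apply: leq_trans h; rewrite leq_pmull.
split=> //; by rewrite -(@leq_pmul2r (2 ^ (2 * n))) ?expn_gt0 // -expnD subnK.
Qed.

End Greedy.

Lemma mem_iota0 k m : (k \in iota 0 m) = (k < m).
Proof. by rewrite mem_iota add0n. Qed.

Lemma wide_prefix c n L t t' : prefix t t' -> wide c n L t -> wide c n L t'.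
Proof.
move=> h hw; apply: leq_trans hw _; apply: leq_cnt => s _; exact: accepts_prefix.
Qed.

Lemma computable_cnt X {A : Type} {HA : Enc A} (L : A -> nat) (P : A -> seq bool -> bool) :
  computable X L -> computable X (fun p => P p.1 p.2) ->
  computable X (fun a => cnt (L a) (P a)).
Proof.
move=> hL hP; have hb := computable_bits X.
apply: (@computable_sum _ _ _ (fun a => 2 ^ L a) (fun a i => P a (bits (L a) i))); comp_auto.
Qed.

Lemma computable_ones X {A : Type} {HA : Enc A} (L : A -> nat) (F : A -> seq bool) :
  computable X L -> computable X F -> computable X (fun a => ones (L a) (F a)).
Proof.
move=> hL hF.
apply: (@computable_sum _ _ _ (fun a => 2 ^ L a) (fun a i => nth false (F a) i)); comp_auto.
Qed.

Ltac comp_cnt :=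
  repeat (comp_auto; lazymatch goal with
  | |- computable _ (fun a => cnt (@?L a) (@?P a)) => refine (@computable_cnt _ _ _ L P _ _)
  | |- computable _ (fun a => ones (@?L a) (@?F a)) => refine (@computable_ones _ _ _ L F _ _)
  end); comp_auto.

Lemma computable_greedy X c :
  computable X (fun p : nat * nat * nat => greedy c p.1.1 p.1.2 p.2).
Proof.
have ha := computable_accepts X c; have hb := computable_bits X.
by rewrite /greedy /elect /votes /missed /wide /hits; comp_cnt.
Qed.

(** * Halting times *)

(** The graph of the partial function t of the overview: [L] is t_e. *)
Definition enters e L :=
  certificate e (unstr L) && ~~ has (fun K => certificate e (unstr K)) (iota 0 L).

Lemma computable_enters X : computable X (fun p : nat * nat => enters p.1 p.2).
Proof. by have hc := computable_certificate X; rewrite /enters; comp_auto. Qed.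

Lemma enters_functional e L L' : enters e L -> enters e L' -> L = L'.
Proof.
move=> /andP[h1 /hasPn h2] /andP[h3 /hasPn h4]; case: (ltngtP L L') => // h.
  by have := h4 L; rewrite mem_iota h1 => /(_ h).
by have := h2 L'; rewrite mem_iota h3 => /(_ h).
Qed.

Lemma halting_enters e : halting_problem e <-> exists L, enters e L.
Proof.
rewrite halting_certificate; split=> [[D hD]|[L /andP[h _]]]; last by exists (unstr L).
have hex : exists L, certificate e (unstr L) by exists (str_num D); rewrite str_numK.
case: (ex_minnP hex) => L hL hmin; exists L; rewrite /enters hL /=; apply/hasPn => K.
by rewrite mem_iota add0n => /= hK; apply/negP => /hmin; rewrite leqNgt hK.
Qed.

(** If [f] bounded the halting times from [n0] on, [z] would decide halting by searching for a
    certificate up to [f n + B], where [B] bounds the finitely many earlier halting times. *)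
Lemma computable_domination z f n0 :
  computable z f -> ~ turing_le halting_problem z ->
  exists n L, [/\ n0 <= n, enters n L & f n < L].
Proof.
move=> hf hz; apply: NNPP => hn; apply: hz.
have hb n L : n0 <= n -> enters n L -> L <= f n.
  by move=> h1 h2; rewrite leqNgt; apply/negP => h3; apply: hn; exists n, L.
have [B hB] : exists B, forall n L, n < n0 -> enters n L -> L <= B.
  have [|B hB] := @eventually_all (fun n B => forall L, enters n L -> L <= B) n0.
    move=> n _; case: (classic (exists L, enters n L)) => [[L hL]|h].
      by exists L => r hr L' /(enters_functional hL) <-.
    by exists 0 => r _ L hL; case: h; exists L.
  by exists B => n L hn0; apply: hB.
have he := computable_enters z.
have [c hc] : computable z (fun n => has (enters n) (iota 0 (f n + B).+1)) by comp_auto.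
exists c => n; have := hc n; rewrite /enc /Enc_nat /Enc_bool.
case: hasP => [[L _ hL]|h] hev; split=> // hh.
  by case: hh; apply/halting_enters; exists L.
move/halting_enters: hh => [L hL]; case: h; exists L => //; rewrite mem_iota add0n ltnS /=.
case: (leqP n0 n) => hn0; first exact: leq_trans (hb _ _ hn0 hL) (leq_addr _ _).
exact: leq_trans (hB _ _ hn0 hL) (leq_addl _ _).
Qed.

Lemma eval_search X {A B} {HA : Enc A} {HB : Enc B} (P : A -> nat -> bool) (g : A -> nat -> B) :
  computable X (fun p : A * nat => P p.1 p.2) -> computable X (fun p : A * nat => g p.1 p.2) ->
  exists c, forall a v, eval X c (enc a) v <->
    exists y, [/\ P a y, forall k, k < y -> ~~ P a k & v = enc (g a y)].
Proof.
(* [Mu] looks for the value 0, hence the negation of [P]. *)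
move=> hP [d hd]; have [e he] : computable X (fun p : A * nat => ~~ P p.1 p.2) by comp_auto.
exists (Comp d (Pair (Pair Fst Snd) (Mu e))) => a v.
have hid y : eval X (Pair (Pair Fst Snd) (Mu e)) (enc a) y <->
    exists m, eval X (Mu e) (enc a) m /\ y = enc (a, m).
  split=> [[b [m [[b' [b'' [-> -> ->]]] hm ->]]]|[m [hm ->]]].
    by exists m; rewrite npair_eta.
  by exists (enc a), m; split=> //; exists (nfst (enc a)), (nsnd (enc a)); rewrite npair_eta.
have hmu m : eval X (Mu e) (enc a) m <-> P a m /\ forall k, k < m -> ~~ P a k.
  split=> [[h0 hk]|[h0 hk]].
    split=> [|k /hk [u hu]].
      by have := eval_functional h0 (he (a, m)); rewrite /enc /Enc_bool /=; case: (P a m).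
    by have := eval_functional hu (he (a, k)); rewrite /enc /Enc_bool /=; case: (P a k).
  split=> [|k /hk h].
    by have := he (a, m); rewrite /enc /Enc_bool /= h0.
  by exists 0; have := he (a, k); rewrite /enc /Enc_bool /= h.
split=> [[y /hid [m [/hmu [h1 h2] ->]] hv]|[m [h1 h2 ->]]].
  by exists m; split=> //; apply: eval_functional hv (hd (a, m)).
exists (enc (a, m)); last exact: (hd (a, m)).
by apply/hid; exists m; split=> //; apply/hmu.
Qed.

Lemma computable_ex_minn X {A} {HA : Enc A} (P : A -> nat -> bool) (H : forall a, exists y, P a y) :
  computable X (fun p : A * nat => P p.1 p.2) -> computable X (fun a => ex_minn (H a)).
Proof.
move=> hP.
have [c hc] := @eval_search X A nat _ _ P (fun _ y => y) hP (computable_snd (computable_id _)).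
exists c => a; apply/hc; case: ex_minnP => y hy hmin; exists y; split=> // k hk.
by apply/negP => /hmin; rewrite leqNgt hk.
Qed.

(** * Compression of the enumerated strings *)

(** The length of the initial block of [true]. It equals [size p] when no [false] occurs, which
    [found] rules out. *)
Definition lead p := find (fun k => ~~ nth false p k) (iota 0 (size p)).

(* The machine reads p = 1^n 0 b and searches for y = <L, r>, where r is the stage at
   which the element with index b is enumerated. As L is determined by n, so is
   the length L - 2n of b, and the machine is prefix-free. *)
Definition found c p y :=
  [&& lead p < size p, enters (lead p) (nfst y), ~~ quiet c (lead p) (nfst y) (nsnd y) &
      str_num (drop (lead p).+1 p) == (2 ^ (nfst y - 2 * lead p)).-1 +
        ones (nfst y) (greedy c (lead p) (nfst y) (nsnd y))].

Definition target c p y :=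
  bits (nfst y) (elect c (lead p) (nfst y) (greedy c (lead p) (nfst y) (nsnd y)) (nsnd y)).

Lemma computable_found X c : computable X (fun a : seq bool * nat => found c a.1 a.2).
Proof.
have ha := computable_accepts X c; have hb := computable_bits X.
have hg := computable_greedy X c; have he := computable_enters X.
rewrite /found /lead /quiet /elect /votes /missed /wide /hits; comp_cnt.
Qed.

Lemma computable_target X c : computable X (fun a : seq bool * nat => target c a.1 a.2).
Proof.
have ha := computable_accepts X c; have hb := computable_bits X.
have hg := computable_greedy X c.
rewrite /target /lead /elect /votes /missed /wide /hits; comp_cnt.
Qed.

(** The strings of length l have the numbers from 2^l - 1 to 2^(l+1) - 2; hence the offset in
    [found]. *)
Lemma str_num_size s : 2 ^ size s <= (str_num s).+1 < 2 ^ (size s).+1.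
Proof. by elim: s => // b s /= ; rewrite !expnS; case: b; lia. Qed.

Lemma size_str_numP s l : 2 ^ l <= (str_num s).+1 < 2 ^ l.+1 -> size s = l.
Proof.
move=> /andP[h1 h2]; have /andP[h3 h4] := str_num_size s.
by have := leq_ltn_trans h1 h4; have := leq_ltn_trans h3 h2; rewrite !ltn_exp2l //; lia.
Qed.

Lemma leadE n b : lead (nseq n true ++ false :: b) = n.
Proof.
rewrite /lead; set p := _ ++ _.
have hn : n < size p by rewrite size_cat size_nseq /=; lia.
have := findE (fun k => ~~ nth false p k) (size p) n; rewrite hn andbT => h; apply/eqP.
rewrite {}h nth_cat size_nseq ltnn subnn /=; apply/allP => i; rewrite mem_iota /= => hi.
by rewrite nth_cat size_nseq hi nth_nseq hi.
Qed.

Lemma found_size c p y : found c p y -> size p = (lead p).+1 + (nfst y - 2 * lead p).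
Proof.
case/and4P=> hl _ /ones_lt [_ hc] /eqP e.
have <- : size (drop (lead p).+1 p) = nfst y - 2 * lead p.
  apply: size_str_numP; rewrite e expnS.
  have : 0 < 2 ^ (nfst y - 2 * lead p) by rewrite expn_gt0.
  lia.
by rewrite size_drop subnKC.
Qed.

(** The leading block determines L, and the index then determines the stage by [ones_inj]. *)
Lemma found_unique c p y y' : found c p y -> found c p y' -> y = y'.
Proof.
move=> /and4P[_ e1 q1 /eqP n1] /and4P[_ e2 q2 /eqP n2].
rewrite -(npair_eta y) -(npair_eta y'); move: q2 n2; rewrite -(enters_functional e1 e2) => q2 n2.
congr npair; apply: ones_inj q1 q2 _; lia.
Qed.

Lemma lead_prefix p q : prefix p q -> lead p < size p -> lead q = lead p.
Proof.
move=> /prefixP[r ->] h; apply/eqP.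
have := findE (fun k => ~~ nth false p k) (size p) (lead p); rewrite h eqxx /=.
move=> /esym/andP[h1 /allP h2].
have hs : lead p < size (p ++ r) by rewrite size_cat ltn_addr.
have := findE (fun k => ~~ nth false (p ++ r) k) (size (p ++ r)) (lead p); rewrite hs andbT => ->.
rewrite nth_cat h h1 /=; apply/allP => i hi; have := h2 i hi.
by rewrite nth_cat; move: hi; rewrite mem_iota /= => hi; rewrite (ltn_trans hi h).
Qed.

Lemma greedy_machine c : exists M, prefix_free M /\
  forall n L s i, enters n L -> nth false (greedy c n L s) i ->
  exists p, machine M p (bits L i) /\ size p + n = L.+1.
Proof.
have [M hM] := eval_search (computable_found emptyset c) (computable_target emptyset c).
have hMp p s : machine M p s <-> exists2 y, found c p y & s = target c p y.
  rewrite /machine (hM p); split=> [[y [h1 _ /str_num_inj h2]]|[y h1 ->]]; first by exists y.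
  by exists y; split=> // k hk; apply/negP => h2; rewrite (found_unique h2 h1) ltnn in hk.
exists M; split.
  move=> p q s t /hMp [y hy _] /hMp [y' hy' _] hpq; have h := hy.
  (* Comparable programs share the leading block, hence L, hence by [found_size] their length. *)
  have hl : lead q = lead p by apply: lead_prefix => //; case/and4P: hy.
  have := found_size hy'; have := found_size hy; rewrite hl.
  have -> : nfst y' = nfst y.
    case/and4P: hy hy' => _ e1 _ _ /and4P[_ e2 _ _]; move: e2; rewrite hl => e2.
    exact: enters_functional e2 e1.
  move=> <- es; case/prefixP: hpq => r e; move: es; rewrite e size_cat => es.
  have -> : r = [::] by apply/size0nil/(@addnI (size p)); rewrite es addn0.
  by rewrite cats0.
move=> n L s i hL /greedy_elect [r [hr hi]].
have [h2 hc] := ones_lt hr.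
(* By [ones_lt] this has length L-2n, so the program has length n + 1 + (L-2n) = L + 1 - n. *)
pose b := unstr ((2 ^ (L - 2 * n)).-1 + ones L (greedy c n L r)).
pose p := nseq n true ++ false :: b.
have hf : found c p (npair L r).
  rewrite /found leadE nfst_pair nsnd_pair hL hr /=; apply/andP; split.
    by rewrite size_cat size_nseq /=; lia.
  by rewrite /p -cat_rcons drop_size_cat ?size_rcons ?size_nseq // unstrK.
exists p; split; last by rewrite (found_size hf) leadE nfst_pair; lia.
by apply/hMp; exists (npair L r) => //; rewrite /target leadE nfst_pair nsnd_pair hi.
Qed.

(** The set of lengths of programs for [s] is undecidable in general, so its least element is
    obtained classically. *)
Lemma machine_complexity M p s : machine M p s -> exists2 k, complexity M s k & k <= size p.
Proof.
move=> hp; pose Q k := exists2 p, machine M p s & size p = k.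
have [k [hk hmin]] : exists k, Q k /\ forall j, Q j -> k <= j.
  apply: NNPP => hn; have hall m : forall k, k < m -> ~ Q k.
    elim: m => // m IH k; rewrite ltnS leq_eqVlt => /orP[/eqP ->|/IH //] hQ.
    by apply: hn; exists m; split=> // j hj; rewrite leqNgt; apply/negP => /IH.
  by apply: (hall (size p).+1 (size p)) => //; exists p.
exists k; first by split=> // q hq; apply: hmin; exists q.
by apply: hmin; exists p.
Qed.

(** * The Martin-Loef test *)

Definition first_quiet c n L s0 s :=
  [&& s0 <= s, quiet c n L s & ~~ has (fun r => (s0 <= r) && quiet c n L r) (iota 0 s)].

Lemma exists_first_quiet c n L s0 : exists s, first_quiet c n L s0 s.
Proof.
have hex : exists s, (s0 <= s) && quiet c n L s.
  by have [s h1 h2] := exists_quiet c n L s0; exists s; rewrite h1.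
case: (ex_minnP hex) => s /andP[h1 h2] hmin; exists s; rewrite /first_quiet h1 h2 /=.
by apply/hasPn => r; rewrite mem_iota add0n /= => hr; apply/negP => /hmin; rewrite leqNgt hr.
Qed.

Lemma first_quiet_unique c n L s0 s s' :
  first_quiet c n L s0 s -> first_quiet c n L s0 s' -> s = s'.
Proof.
move=> /and3P[h1 h2 /hasPn h3] /and3P[h1' h2' /hasPn h3']; case: (ltngtP s s') => // h.
  by have := h3' s; rewrite mem_iota h1 h2 => /(_ h).
by have := h3 s'; rewrite mem_iota h1' h2' => /(_ h).
Qed.

(** [L] and [K] are t_n and t_k. Waiting from n + L + K on makes n, L and K at most [size t], within
    reach of the bounded searches. All strings accepted for given k and n have the same length. *)
Definition test_at c k n t :=
  has (fun L => has (fun K =>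
    [&& enters n L, enters k K, first_quiet c n L (n + L + K) (size t) &
        missed c n L (greedy c n L (size t)) t])
    (iota 0 (size t).+1)) (iota 0 (size t).+1).

Definition test c i t :=
  has (fun k => has (fun n => (i <= k <= n) && test_at c k n t)
    (iota 0 (size t).+1)) (iota 0 (size t).+1).

Lemma computable_test X c : computable X (fun p : nat * seq bool => test c p.1 p.2).
Proof.
have ha := computable_accepts X c; have hb := computable_bits X.
have hg := computable_greedy X c; have he := computable_enters X.
rewrite /test /test_at /first_quiet /quiet /elect /votes /missed /wide /hits; comp_cnt.
Qed.

Lemma cnt_take s N (P : pred (seq bool)) :
  s <= N -> cnt N (fun t => P (take s t)) = cnt s P * 2 ^ (N - s).
Proof.
elim: N => [|N IH].
  by rewrite leqn0 => /eqP ->; rewrite muln1; apply: eq_cnt => t; case: t.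
rewrite leq_eqVlt => /orP[/eqP ->|hs].
  by rewrite subnn muln1; apply: eq_cnt => t <-; rewrite take_size.
rewrite subSn // expnSr mulnA muln2 -addnn -IH // cntS.
by congr (_ + _); apply: eq_cnt => t ht; rewrite -cats1 takel_cat // ht.
Qed.

Lemma geometric_sum (a : nat -> nat) i m M :
  (forall n, n < m -> i <= n -> a n * 2 ^ n.+1 <= M) ->
  (\sum_(n < m | i <= n) a n) * 2 ^ i <= M.
Proof.
move=> ha; case: (leqP i m) => hm; last first.
  by rewrite big1 // => n; have := ltn_ord n; lia.
(* Strengthened for the induction on [m]: the sum is at most M(2^-i - 2^-m). *)
suff h : (\sum_(n < m | i <= n) a n) * 2 ^ m + M <= M * 2 ^ (m - i).
  rewrite -(@leq_pmul2r (2 ^ (m - i))) ?expn_gt0 // -mulnA -expnD subnKC //.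
  by apply: leq_trans h; rewrite leq_addr.
elim: m ha hm => [|m IH] ha hm.
  by rewrite big_ord0 add0n leq_pmulr ?expn_gt0.
move: hm; rewrite leq_eqVlt => /orP[/eqP e|him].
  rewrite e subnn muln1 big1 // => n; have := ltn_ord n; lia.
rewrite ltnS in him; rewrite big_mkcond big_ord_recr -big_mkcond /= him subSn //.
have := IH (fun n h => ha n (ltnW h)) him; have := ha m (ltnSn m) him.
by rewrite !expnS; move: (\sum_(_ < m | _) _) (2 ^ m) (2 ^ (m - i)) => S p q; nia.
Qed.

(** [L], [K] and the first quiet stage are unique, so all strings concerned have one length, at
    which [quiet_missed] applies. *)
Lemma test_at_measure c k n N :
  cnt N (fun t => has (fun s => test_at c k n (take s t)) (iota 0 N.+1)) * 2 ^ (2 * n + 2) <= 2 ^ N.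
Proof.
set B := fun t => _.
case: (classic (exists2 t, size t = N & B t)) => [[t ht]|hn]; last first.
  rewrite (_ : cnt N B = 0) //; apply: big1 => i _; apply/eqP; rewrite eqb0; apply/negP => h.
  by apply: hn; exists (bits N i); rewrite ?size_bits.
case/hasP => s; rewrite mem_iota add0n ltnS /= => hs /hasP[L _ /hasP[K _]].
have szt u r : size u = N -> r <= N -> size (take r u) = r.
  by move=> <- h; rewrite size_takel.
rewrite szt // => /and4P[hL hK hq _].
have -> : 2 ^ N = 2 ^ s * 2 ^ (N - s) by rewrite -expnD subnKC.
apply: (@leq_trans (cnt N (fun u => missed c n L (greedy c n L s) (take s u)) * 2 ^ (2 * n + 2))).
  rewrite leq_mul2r; apply/orP; right; apply: leq_cnt => u hu /hasP[r].
  rewrite mem_iota add0n ltnS /= => hr /hasP[L' _ /hasP[K' _]].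
  rewrite szt // => /and4P[hL' hK' hq']; rewrite -(enters_functional hL hL').
  move: hq'; rewrite -(enters_functional hL hL') -(enters_functional hK hK') => hq'.
  by rewrite (first_quiet_unique hq' hq).
rewrite cnt_take // mulnAC leq_mul2r; apply/orP; right.
by apply: quiet_missed; case/and3P: hq.
Qed.

(** A union bound with two geometric sums: 2^-(2n+2) is at most 2^-(n+1) 2^-(k+1) for k <= n.
    Summing over n >= k gives at most 2^-(2k+1), hence at most 2^-(k+1), and summing over k >= i
    gives 2^-i. *)
Lemma test_measure c i : open_measure_le (test c i) i.
Proof.
move=> N A hA.
pose B k n t := has (fun s => test_at c k n (take s t)) (iota 0 N.+1).
have h1 : #|A| <= \sum_(k < N.+1 | i <= k) \sum_(n < N.+1 | k <= n) cnt N (B k n).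
  apply: (@leq_trans #|[set t : N.-tuple bool | has (fun k => has (fun n =>
      (i <= k <= n) && B k n t) (iota 0 N.+1)) (iota 0 N.+1)]|).
    apply: subset_leq_card; apply/subsetP => t ht0; have [s hs hp] := hA t ht0; rewrite inE.
    have hsN : size s <= N by have := size_prefix hp; rewrite size_tuple.
    case/hasP: hs => k; rewrite mem_iota0 => hk /hasP[n]; rewrite mem_iota0 => hn /andP[hi ht].
    apply/hasP; exists k; first by rewrite mem_iota0; lia.
    apply/hasP; exists n; first by rewrite mem_iota0; lia.
    rewrite hi; apply/hasP; exists (size s); first by rewrite mem_iota0; lia.
    by move: hp; rewrite prefixE => /eqP ->.
  rewrite (card_cnt N (fun t => has (fun k => has (fun n =>
      (i <= k <= n) && B k n t) (iota 0 N.+1)) (iota 0 N.+1))).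
  rewrite /cnt; under [leqRHS]eq_bigr => k _ do rewrite exchange_big.
  rewrite exchange_big; apply: leq_sum => j _.
  case: hasP => // -[k]; rewrite mem_iota0 => hk /hasP[n]; rewrite mem_iota0 => hn.
  move=> /andP[/andP[hi hkn] ht].
  by rewrite (bigD1 (Ordinal hk)) //= (bigD1 (Ordinal hn)) //= ht.
apply: leq_trans (leq_mul h1 (leqnn _)) _.
apply: (@geometric_sum (fun k => \sum_(n < N.+1 | k <= n) cnt N (B k n))) => k hk hi.
have := @geometric_sum (fun n => cnt N (B k n) * 2 ^ k.+1) k N.+1 (2 ^ N).
rewrite -big_distrl /= => h; apply: leq_trans (h _); first by rewrite leq_pmulr ?expn_gt0.
move=> n hn hkn; apply: leq_trans (test_at_measure c k n N).
by rewrite -mulnA -expnD leq_mul2l leq_exp2l //; apply/orP; right; lia.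
Qed.

Lemma exists_test c : exists d, ML_test d /\ forall i s, unif_ce d i s <-> test c i s.
Proof.
have ht := computable_test emptyset c.
(* The predicate ignores the search variable, so the search stops at 0 or never. *)
have [|d hd] := @eval_search emptyset (nat * seq bool) nat _ _
  (fun p _ => test c p.1 p.2) (fun _ y => y) _ (computable_snd (computable_id _)).
  by comp_auto.
have h i s : unif_ce d i s <-> test c i s.
  split=> [[v /(hd (i, s)) [y []//]]|hs].
  by exists 0; apply/(hd (i, s)); exists 0.
exists d; split=> // i N A hA; apply: (@test_measure c) => t /hA [s /h]; by exists s.
Qed.

(** * The theorem *)

(** In a pruned tree every node has a child, so the width never decreases. *)
Lemma pruned_cnt T L M : tree T -> pruned_tree T -> L <= M -> cnt L T <= cnt M T.
Proof.
move=> [_ hT] hp; elim: M => [|M IH]; first by rewrite leqn0 => /eqP ->.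
rewrite leq_eqVlt => /orP[/eqP -> //|/IH h]; apply: leq_trans h _.
rewrite cntS -big_split /=; apply: leq_sum => i _; case: (boolP (T _)) => // hs.
have [t [ht /prefixP [[|b r] et] hne]] := hp _ hs.
  by rewrite et cats0 eqxx in hne.
have : T (rcons (bits M i) b).
  by apply: hT ht; rewrite et -cat_rcons prefix_prefix.
by case: b {et} => ->; rewrite ?addn1 ?add1n.
Qed.

Theorem theorem1p3 (U : code) (hU : universal_prefix_free U)
    (z : nat -> bool) (hz : ML_random z)
    (T : pred (seq bool)) (hT : tree T) (hproper : proper_tree T)
    (hpruned : pruned_tree T) (hinc : incompressible U T)
    (hTz : turing_le (string_set T) z) :
  turing_le halting_problem z.
Proof.
apply: NNPP => hhalt; have [c hc] := hTz.
have hcT s : eval z c (str_num s) (T s).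
  have [h1 h0] := hc (str_num s); case: (boolP (T s)) => hs; first by apply: h1; exists s.
  by apply: h0 => -[s' hs' /str_num_inj e]; rewrite e hs' in hs.
have compT : computable z T by exists c.
have sound t s : initial z t -> accepts c t s -> T s.
  move=> ht /eqP /(run_sound ht) /eval_functional /(_ (hcT s)).
  by case: (T s).
have complete s : T s -> exists r0, forall r, r0 <= r -> accepts c (mkseq z r) s.
  move=> hs; have [r0 hr0] := run_complete (hcT s); exists r0 => r /hr0.
  by rewrite hs /accepts => ->.
have avoid : exists n0, forall n L s t, n0 <= n -> enters n L -> initial z t ->
    ~~ hits c L (greedy c n L s) t.
  have [M [hM hMc]] := greedy_machine c; have [d hd] := hU.2 M hM; have [e he] := hinc.
  (* A string of F_n in T has complexity at most L + 1 - n + d, while incompressibility gives at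
     least L - e; so n <= d + e + 1. *)
  exists (d + e + 2) => n L s t hn hL ht; apply/hasPn => i; rewrite mem_iota0 => hi.
  apply/negP => /andP[hF /(sound _ _ ht) hTi].
  have [p [hp hpn]] := hMc n L s i hL hF.
  have [k hk hkp] := machine_complexity hp.
  have [k' hk' hkk'] := hd _ _ hk.
  have := he _ _ hTi hk'; rewrite size_bits; lia.
have [n0 hn0] := avoid.
have hwidth n : exists L, 2 ^ (4 * n + 2) <= cnt L T.
  by have [L hL] := hproper (2 ^ (4 * n + 2)); exists L; rewrite card_cnt in hL; apply: ltnW.
have comp_width : computable z (fun n => ex_minn (hwidth n)).
  by apply: computable_ex_minn; comp_cnt.
have hwide k : exists r, has (fun n => has (fun L =>
    [&& k <= n, enters n L & wide c n L (mkseq z r)]) (iota 0 r.+1)) (iota 0 r.+1).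
  (* First use of domination: t_n = L lies above the least level of width w_n, so T has that width
     at level L as well. *)
  have [n [L [hkn hL]]] := computable_domination k comp_width hhalt.
  case: ex_minnP => L0 hL0 _ hlt.
  have [r1 hr1] : exists r0, forall r, r0 <= r -> forall i, i < 2 ^ L ->
      T (bits L i) -> accepts c (mkseq z r) (bits L i).
    apply: (@eventually_all (fun i r => T (bits L i) -> accepts c (mkseq z r) (bits L i))) => i _.
    case: (boolP (T (bits L i))) => hi; last by exists 0.
    by have [r0 hr0] := complete _ hi; exists r0 => r /hr0.
  (* Beyond [r1] the oracle accepts all strings of T of length L; [n] and [L] bring both indices
     within the bounded searches. *)
  pose r := maxn r1 (maxn n L); exists r.
  apply/hasP; exists n; first by rewrite mem_iota0 /r; lia.
  apply/hasP; exists L; first by rewrite mem_iota0 /r; lia.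
  rewrite hkn hL /=; apply: leq_trans hL0 _; apply: leq_trans (pruned_cnt hT hpruned (ltnW hlt)) _.
  apply: leq_sum => i _; case: (boolP (T _)) => // hi.
  by rewrite hr1 // /r leq_maxl.
have comp_wide : computable z (fun k => ex_minn (hwide k)).
  have he := computable_enters z; have ha := computable_accepts z c.
  have hzz : computable z z by apply: computable_oracle; apply: computable_id.
  by apply: computable_ex_minn; rewrite /wide; comp_cnt.
have [d [hd htest]] := exists_test c.
apply: (hz d hd) => i.
(* Second use of domination: t_k = K exceeds the least stage [r] that witnesses width for some n >=
   k. Here k >= i serves the test and k >= [n0] serves [avoid]. *)
have [k [K [hk hK]]] := computable_domination (maxn i n0) comp_wide hhalt.
case: ex_minnP => r /hasP[n _ /hasP[L _ /and3P[hkn hL hw]]] _ hr.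
have [s hs] := exists_first_quiet c n L (n + L + K).
have hles : n + L + K <= s by case/and3P: hs.
exists s; apply/htest; rewrite /test size_mkseq.
apply/hasP; exists k; first by rewrite mem_iota0; lia.
apply/hasP; exists n; first by rewrite mem_iota0; lia.
have -> : i <= k <= n by lia.
rewrite /test_at size_mkseq.
apply/hasP; exists L; first by rewrite mem_iota0; lia.
apply/hasP; exists K; first by rewrite mem_iota0; lia.
(* The segment of [z] of length [s] is wide because r < K <= s, and it is not hit by [avoid]; so it
   is missed. *)
rewrite hL hK hs !andTb; apply/andP; split.
  by apply: wide_prefix hw; apply: prefix_mkseq; lia.
by apply: hn0 hL (initial_mkseq z s); lia.
Qed.
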